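(* Let $n\ge 2$ and $m\ge 1$. Let $A$ be a centrally symmetric convex body in $\mathbb{R}^n$ with a smooth boundary, and let $B$ be any bounded, measurable set in $\mathbb{R}^m$. Then the product set $\Omega=A\times B\subset\mathbb{R}^n\times\mathbb{R}^m$ is not spectral.
   Context: A bounded, measurable set $\Omega\subset\mathbb{R}^d$ of positive Lebesgue measure is called spectral if there exists a countable set $\Lambda\subset\mathbb{R}^d$ (called a spectrum for $\Omega$) such that the system of exponential functions $E(\Lambda)=\{e_\lambda\}_{\lambda\in\Lambda}$, $e_\lambda(x)=e^{2\pi i\langle\lambda,x\rangle}$, is orthogonal and complete in $L^2(\Omega)$, i.e. is an orthogonal basis of $L^2(\Omega)$. (In particular, a spectral set has positive measure by definition.) A convex body in $\mathbb{R}^n$ is a compact convex set with nonempty interior. It is centrally symmetric if $-A$ is a translate of $A$. It has a smooth boundary if its boundary is a $C^\infty$ hypersurface in $\mathbb{R}^n$. *)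

(* Defs.v *)
From HB Require Import structures.
From mathcomp Require Import all_boot all_order all_algebra.
From mathcomp Require Import all_classical all_reals all_analysis.
From mathcomp.real_closed Require Import complex.

Set Implicit Arguments.
Unset Strict Implicit.
Unset Printing Implicit Defensive.

Import Order.TTheory GRing.Theory Num.Theory.
Import numFieldTopology.Exports numFieldNormedType.Exports.

Local Open Scope classical_set_scope.
Local Open Scope ring_scope.

Definition rV_display : measure_display.
Proof. exact: default_measure_display. Qed.

Section rV_measurable.
Context (R : realType) (n : nat).

Definition rV_coord (i : 'I_n) (v : 'rV[R]_n) : measurableTypeR R := v 0 i.

Let rV_set0 : g_sigma_preimage rV_coord set0.
Proof. exact: sigma_algebra0. Qed.

Let rV_setC A : g_sigma_preimage rV_coord A ->
  g_sigma_preimage rV_coord (~` A).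
Proof. exact: sigma_algebraC. Qed.

Let rV_bigcup (F : _^nat) : (forall i, g_sigma_preimage rV_coord (F i)) ->
  g_sigma_preimage rV_coord (\bigcup_i (F i)).
Proof. exact: sigma_algebra_bigcup. Qed.

(* The Borel sigma-algebra of R^n, generated by the coordinates. *)
HB.instance Definition _ := @isMeasurable.Build rV_display
  'rV[R]_n (g_sigma_preimage rV_coord) rV_set0 rV_setC rV_bigcup.

Lemma measurable_rV_coord (i : 'I_n) : measurable_fun setT (rV_coord i).
Proof.
move=> _ Y mY; rewrite setTI; apply: sub_sigma_algebra => /=.
rewrite -bigcup_seq/=; exists i => /=; first by rewrite mem_index_enum.
by exists Y => //; rewrite setTI.
Qed.

Lemma measurable_fun_rV d (T : measurableType d) (f : T -> 'rV[R]_n) :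
  (forall i, measurable_fun setT (rV_coord i \o f)) -> measurable_fun setT f.
Proof.
move=> mf _ Y mY; rewrite setTI.
suff : g_sigma_preimage rV_coord `<=` [set A | measurable (f @^-1` A)].
  by apply.
apply: smallest_sub => /=.
  split => [|A mA|F mF] /=.
  - by rewrite preimage_set0.
  - by rewrite setTD preimage_setC; exact: measurableC.
  - by rewrite preimage_bigcup; by apply: bigcupT_measurable => k; exact: mF.
move=> A; rewrite -bigcup_seq => -[i _ [B mB <-]] /=.
by rewrite setTI -comp_preimage -[X in measurable X]setTI; exact: mf.
Qed.

End rV_measurable.

Section cons_measure.
Context (R : realType) (n : nat).

Definition rV_cons (p : measurableTypeR R * 'rV[R]_n) : 'rV[R]_n.+1 :=
  row_mx (p.1 : R)%:M p.2.

Lemma rV_cons0 p : rV_cons p 0 ord0 = p.1.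
Proof.
rewrite (_ : ord0 = @lshift 1 n ord0); last exact: val_inj.
by apply: etrans (@row_mxEl _ 1 1 n _ _ 0 ord0) _; rewrite mxE eqxx.
Qed.

Lemma rV_consS p (i : 'I_n) : rV_cons p 0 (lift ord0 i) = p.2 0 i.
Proof.
rewrite (_ : lift ord0 i = @rshift 1 n i); last exact: val_inj.
exact: (@row_mxEr _ 1 1 n _ _ 0 i).
Qed.

Lemma measurable_rV_cons : measurable_fun setT rV_cons.
Proof.
apply: measurable_fun_rV => i; have [j ->|->] := unliftP ord0 i.
  rewrite (_ : _ \o _ = @rV_coord R n j \o snd).
    by apply: measurableT_comp; [exact: measurable_rV_coord|exact: measurable_snd].
  by apply/funext => p /=; rewrite /rV_coord rV_consS.
rewrite (_ : _ \o _ = fst); first exact: measurable_fst.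
by apply/funext => p /=; rewrite /rV_coord rV_cons0.
Qed.

HB.instance Definition _ :=
  isMeasurableFun.Build _ _ _ _ rV_cons measurable_rV_cons.

Variable mu : {sigma_finite_measure set 'rV[R]_n -> \bar R}.

Definition cons_measure : set 'rV[R]_n.+1 -> \bar R :=
  pushforward (@lebesgue_measure R \x mu)%E rV_cons.

Let cons_measure0 : cons_measure set0 = 0%E.
Proof. exact: measure0. Qed.

Let cons_measure_ge0 A : (0 <= cons_measure A)%E.
Proof. exact: measure_ge0. Qed.

Let cons_measure_sigma_additive : semi_sigma_additive cons_measure.
Proof. exact: measure_semi_sigma_additive. Qed.

HB.instance Definition _ := isMeasure.Build _ _ _ cons_measure
  cons_measure0 cons_measure_ge0 cons_measure_sigma_additive.

Let cons_measure_sigma_finite : sigma_finite setT cons_measure.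
Proof.
have [F FT Foo] : sigma_finite setT (@lebesgue_measure R \x mu)%E.
  have /sigma_finiteP[F [TF ndF Foo]] := sigma_finiteT (@lebesgue_measure R).
  have /sigma_finiteP[G [TG ndG Goo]] := sigma_finiteT mu.
  exists (fun k => F k `*` G k).
    rewrite -setXTT TF TG predeqE => -[x y]; split.
      move=> [/= [k _ Fkx] [l _ Gly]]; exists (maxn k l) => //; split.
      - by move: x Fkx; exact/subsetPset/ndF/leq_maxl.
      - by move: y Gly; exact/subsetPset/ndG/leq_maxr.
    by move=> [k _ []/= ? ?]; split; exists k.
  move=> k; have [? ?] := Foo k; have [? ?] := Goo k.
  split; first exact: measurableX.
  by rewrite product_measure1E// lte_mul_pinfty// ge0_fin_numE.
pose tl (v : 'rV[R]_n.+1) : measurableTypeR R * 'rV[R]_n :=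
  (rV_coord ord0 v, \row_i v 0 (lift ord0 i)).
have mtl : measurable_fun setT tl.
  apply/measurable_fun_pairP; split; first exact: measurable_rV_coord.
  apply: measurable_fun_rV => i.
  rewrite (_ : _ \o _ = rV_coord (lift ord0 i)); first exact: measurable_rV_coord.
  by apply/funext => v /=; rewrite /rV_coord mxE.
have tlK : cancel rV_cons tl.
  move=> [x v]; rewrite /tl; congr pair; first exact: rV_cons0.
  by apply/rowP => i; rewrite mxE rV_consS.
exists (fun k => tl @^-1` F k).
  by rewrite -preimage_bigcup -FT preimage_setT.
move=> k; have [mF Fk] := Foo k; split.
  by rewrite -[X in measurable X]setTI; exact: mtl.
rewrite /cons_measure /pushforward (_ : _ @^-1` _ = F k)//.
by apply/seteqP; split => p /=; rewrite tlK.
Qed.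

HB.instance Definition _ := Measure_isSigmaFinite.Build _ _ _ cons_measure
  cons_measure_sigma_finite.

End cons_measure.

Lemma dirac_sigma_finite (R : realType) :
  sigma_finite setT (dirac (0 : 'rV[R]_0) : set 'rV[R]_0 -> \bar R).
Proof.
exists (fun=> setT); first by rewrite bigcup_const.
by move=> _; split => //; rewrite /= diracT ltry.
Qed.

(* Lebesgue measure on the Borel sets of R^n, the n-fold product of the Lebesgue
   measure of R. *)
Fixpoint borel_lebesgue (R : realType) (n : nat) :
    {sigma_finite_measure set 'rV[R]_n -> \bar R} :=
  if n is n'.+1 return {sigma_finite_measure set 'rV[R]_n -> \bar R}
  then cons_measure (borel_lebesgue R n') else dirac (0 : 'rV[R]_0).

Lemma borel_lebesgue_prod (R : realType) (n : nat)
    (A : 'I_n -> set (measurableTypeR R)) : (forall i, measurable (A i)) ->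
  borel_lebesgue R n [set v | forall i, A i (v 0 i)] =
  (\prod_(i < n) lebesgue_measure (A i))%E.
Proof.
elim: n A => [A _|n IHn A mA].
  by rewrite big_ord0 /= diracE mem_set//= => -[].
rewrite big_ord_recl -IHn; last by move=> i; exact: mA.
have mB : measurable [set v : 'rV[R]_n | forall i, A (lift ord0 i) (v 0 i)].
  rewrite (_ : mkset _ = \bigcap_(i in [set: 'I_n])
      (@rV_coord R n i @^-1` A (lift ord0 i))).
    apply: fin_bigcap_measurable => // i _.
    rewrite -[X in measurable X]setTI.
    by apply: measurable_rV_coord => //; exact: mA.
  by apply/seteqP; split => v /= Av i; [move=> _; exact: Av|exact: Av].
rewrite -(product_measure1E _ _ (mA ord0) mB).
rewrite /= /cons_measure /pushforward; congr (product_measure1 _ _ _).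
apply/seteqP; split => p /=.
  move=> Ap; split => [|i]; first by rewrite -[p.1]rV_cons0; exact: Ap.
  by rewrite -rV_consS; exact: Ap.
move=> [A0 AS] i; have [j ->|->] := unliftP ord0 i.
  by rewrite rV_consS; exact: AS.
by rewrite rV_cons0.
Qed.

(* R^n with the Lebesgue measurable sets, and the Lebesgue measure: the
   completion of borel_lebesgue. *)
Definition lebesgue_rV (R : realType) (n : nat) :=
  caratheodory_type ((borel_lebesgue R n)^*)%mu.

Definition leb (R : realType) (n : nat) : set (lebesgue_rV R n) -> \bar R :=
  @completed_measure_extension _ _ _ (borel_lebesgue R n).

HB.instance Definition _ (R : realType) (n : nat) := Measurable.on (lebesgue_rV R n).
HB.instance Definition _ (R : realType) (n : nat) := Measure.on (@leb R n).

Section L2.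
Context (R : realType) (d : nat).
Implicit Types (Omega Lambda : set 'rV[R]_d) (f g : 'rV[R]_d -> R[i]).

(* Functions are not quotiented by almost everywhere equality: L2 is a predicate,
   and density below is stated in the L2 seminorm. *)
Definition L2 Omega f :=
  [/\ measurable_fun (Omega : set (lebesgue_rV R d)) (fun x => complex.Re (f x)),
      measurable_fun (Omega : set (lebesgue_rV R d)) (fun x => complex.Im (f x)) &
      (\int[@leb R d]_(x in Omega) (Normc.normc (f x) ^+ 2)%:E < +oo)%E].

Definition L2inner Omega f g : R[i] :=
  let h x := f x * conjc (g x) in
  Complex (\int[@leb R d]_(x in Omega) complex.Re (h x))
          (\int[@leb R d]_(x in Omega) complex.Im (h x)).

Definition dot (u v : 'rV[R]_d) : R := \sum_(i < d) u 0 i * v 0 i.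

(* e^(2 pi i <l, x>) *)
Definition expo (l x : 'rV[R]_d) : R[i] :=
  Complex (cos (2 * pi * dot l x)) (sin (2 * pi * dot l x)).

Definition orthogonal_expos Omega Lambda :=
  forall l l', Lambda l -> Lambda l' -> l <> l' ->
    L2inner Omega (expo l) (expo l') = 0.

(* The linear span of the exponentials is dense in L^2(Omega). *)
Definition complete_expos Omega Lambda :=
  forall f, L2 Omega f -> forall eps : R, 0 < eps ->
  exists (s : seq 'rV[R]_d) (c : 'rV[R]_d -> R[i]),
    (forall l, l \in s -> Lambda l) /\
    (\int[@leb R d]_(x in Omega)
       (Normc.normc (f x - \sum_(l <- s) c l * expo l x) ^+ 2)%:E < eps%:E)%E.

Definition spectrum Omega Lambda :=
  [/\ countable Lambda, orthogonal_expos Omega Lambda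
    & complete_expos Omega Lambda].

Definition spectral Omega :=
  [/\ bounded_set Omega, measurable (Omega : set (lebesgue_rV R d)),
      (0 < leb (Omega : set (lebesgue_rV R d)))%E
    & exists Lambda, spectrum Omega Lambda].

End L2.

Section convex_bodies.
Context (R : realType) (n : nat).
Implicit Types (A S U : set 'rV[R]_n) (g : 'rV[R]_n -> R).

Definition convex_body A :=
  [/\ compact A, @convex_set R 'rV[R]_n A & A° !=set0].

Definition centrally_symmetric A :=
  exists t : 'rV[R]_n, [set - x | x in A] = [set x + t | x in A].

Definition boundary A := closure A `\` A°.

Definition pderive (i : 'I_n) g : 'rV[R]_n -> R :=
  fun x => 'D_(delta_mx 0 i) g x.

(* C^oo on U (meant for U open): all iterated partial derivatives, including g
   itself, exist and are continuous at every point of U. *)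
Definition smooth_on U g :=
  forall (s : seq 'I_n) x, U x ->
    {for x, continuous (foldr pderive g s)} /\
    forall i, derivable (foldr pderive g s) x (delta_mx 0 i).

(* Embedded C^oo hypersurface: locally a regular level set. *)
Definition smooth_hypersurface S :=
  forall p, S p -> exists U g,
    [/\ open U, U p, smooth_on U g,
        forall x, U x -> exists i, pderive i g x != 0
      & S `&` U = [set x | U x /\ g x = 0]].

End convex_bodies.

(* A x B, with R^n x R^m identified with R^(n + m). *)
Definition prod_set (R : realType) (n m : nat)
    (A : set 'rV[R]_n) (B : set 'rV[R]_m) : set 'rV[R]_(n + m) :=
  [set v | A (lsubmx v) /\ B (rsubmx v)].

(* Main.v *)
Require Import Defs.
From HB Require Import structures.
From mathcomp Require Import all_boot all_order all_algebra.
From mathcomp Require Import all_classical all_reals all_analysis.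
From mathcomp Require Import measurable_realfun.
From mathcomp.real_closed Require Import complex.
From mathcomp Require Import ring lra.

(* Let Lambda be a spectrum of Omega = A x B.  By completeness some trigonometric
   polynomial F with frequencies in Lambda is L2(Omega)-close to the indicator of
   W = Omega /\ (Q x R^m), where Q is a small box around the centre p of A.  By
   orthogonality the integral of |F|^2 over a translate of Omega does not depend on
   the translate.  So |F|^2 dx gives every (A + x) x B the same mass k, while the
   mass of (A + x) x B outside W is negligible as soon as A + x contains Q.

   Smoothness of A contradicts this.  Take p = 0 and let p_1, ..., p_N maximise
   pairwise non-parallel linear forms on A.  As A has only one supporting
   hyperplane at each boundary point, (A + p_i) /\ (A + p_j) lies in the interior
   of 2A for i <> j.  Hence, for small h > 0, the sets A + (1 + h) p_i avoid Q and
   meet each other only inside s 2A for some s < 1, which is covered by finitely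
   many A + x with x in s A, all containing Q.  Up to negligible mass these N sets
   are disjoint, so N k is at most the mass of 3A, which is at most M k with M
   independent of N: impossible for N > M. *)

Set Implicit Arguments.
Unset Strict Implicit.
Unset Printing Implicit Defensive.

Import Order.TTheory GRing.Theory Num.Theory.
Import numFieldTopology.Exports numFieldNormedType.Exports.

Local Open Scope classical_set_scope.
Local Open Scope ring_scope.

(** * Translation invariance of Lebesgue measure *)

Lemma measurable_addR (R : realType) (t : R) :
  measurable_fun setT ((fun x => x + t) : measurableTypeR R -> measurableTypeR R).
Proof.
have : measurable_fun [set: measurableTypeR R] ((fun x => x + t) : _ -> R).
  by apply: measurable_funD.
done.
Qed.

(** By uniqueness of Lebesgue measure, it suffices to compare its pushforward under the shift with
    it on half-open intervals. *)
Lemma lebesgue_measure_translate (R : realType) (t : R)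
    (A : set (measurableTypeR R)) : measurable A ->
  lebesgue_measure ((fun x : measurableTypeR R => x + t) @^-1` A) = lebesgue_measure A.
Proof.
pose f := (fun x => x + t) : measurableTypeR R -> measurableTypeR R.
pose mf := isMeasurableFun.Build _ _ _ _ f (@measurable_addR R t).
pose F : {mfun _ >-> _} := HB.pack f mf.
move=> mA; apply/esym.
apply: (@lebesgue_measure_unique R (pushforward lebesgue_measure F)) => //.
move=> X /ocitvP[->|[[a b] ab ->]]; first by rewrite !measure0.
have E : f @^-1` [set` `]a, b]] = [set` `]a - t, b - t]].
  by apply/seteqP; split => x; rewrite /f /= !in_itv/= ltrBlDr lerBrDr.
transitivity (lebesgue_measure ([set` `]a - t, b - t]] : set R)); last by rewrite -E.
rewrite !lebesgue_measure_itv /= !lte_fin ltrBlDr subrK.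
by case: ifP => // _; rewrite -!EFinD; congr (_%:E); ring.
Qed.

(** The set A + t, encoded as a preimage so that measurability and openness pass to it directly. *)
Definition translate (V : zmodType) (A : set V) (t : V) : set V :=
  (fun v => v - t) @^-1` A.

Section translation.
Context (R : realType).

Lemma measurable_rV_add n (t : 'rV[R]_n) :
  measurable_fun setT (fun v : 'rV[R]_n => v + t).
Proof.
apply: measurable_fun_rV => i.
rewrite (_ : _ \o _ = (fun x : measurableTypeR R => x + t 0 i) \o @rV_coord R n i).
  by apply: measurableT_comp; [exact: measurable_addR|exact: measurable_rV_coord].
by apply/funext => v; rewrite /rV_coord /= mxE.
Qed.

Lemma rV_cons_add n (t : 'rV[R]_n.+1) (p : measurableTypeR R * 'rV[R]_n) :
  rV_cons p + t = rV_cons (p.1 + t 0 ord0, p.2 + \row_i t 0 (lift ord0 i)).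
Proof.
apply/rowP => i; rewrite mxE.
by have [j ->|->] := unliftP ord0 i; rewrite ?rV_consS ?rV_cons0 //= !mxE.
Qed.

(** Induction on the dimension: through [rV_cons] a shift acts separately on the first coordinate
    and on the tail, so the two measures agree on rectangles, which determine a product measure. *)
Lemma borel_lebesgue_translate n (t : 'rV[R]_n) (A : set 'rV[R]_n) :
  measurable A -> borel_lebesgue R n ((fun v => v + t) @^-1` A) = borel_lebesgue R n A.
Proof.
elim: n t A => [|n IHn] t A mA.
  by rewrite /= !diracE; congr ((nat_of_bool _)%:R%:E); congr (_ \in A);
    apply/rowP => -[].
rewrite /= /cons_measure /pushforward.
pose f1 := fun x : measurableTypeR R => (x + t 0 ord0 : measurableTypeR R).
pose f2 := fun v : 'rV[R]_n => v + \row_i t 0 (lift ord0 i).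
pose f := fun p : measurableTypeR R * 'rV[R]_n => (f1 p.1, f2 p.2).
have mf1 : measurable_fun setT f1 by exact: measurable_addR.
have mf2 : measurable_fun setT f2 by exact: measurable_rV_add.
have mf : measurable_fun setT f.
  apply/measurable_fun_pairP; split.
    by apply: (measurableT_comp mf1); exact: measurable_fst.
  by apply: (measurableT_comp mf2); exact: measurable_snd.
pose mfB := isMeasurableFun.Build _ _ _ _ f mf.
pose F : {mfun _ >-> _} := HB.pack f mfB.
pose L := @lebesgue_measure R; pose B := borel_lebesgue R n.
have mA' : measurable (@rV_cons R n @^-1` A).
  by rewrite -[X in measurable X]setTI; exact: measurable_rV_cons.
have -> : @rV_cons R n @^-1` ((fun v => v + t) @^-1` A) = f @^-1` (@rV_cons R n @^-1` A).
  by apply/seteqP; split => p /=; rewrite rV_cons_add.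
rewrite -[LHS]/(pushforward (L \x B)%E F (@rV_cons R n @^-1` A)).
apply/esym; apply: product_measure_unique => // X Y mX mY.
transitivity ((L \x B)%E ((f1 @^-1` X) `*` (f2 @^-1` Y))); first by [].
rewrite product_measure1E; last 2 first.
- by rewrite -[X in measurable X]setTI; exact: mf1.
- by rewrite -[X in measurable X]setTI; exact: mf2.
congr (_ * _)%E; first exact: lebesgue_measure_translate.
exact: IHn.
Qed.

Local Notation mue n := ((borel_lebesgue R n)^*)%mu.

(** Shifting every set of a countable cover gives a cover of the shifted set with the same total
    mass. The converse inequality comes from the shift by [- t]. *)
Lemma mu_ext_translate_le n (t : 'rV[R]_n) (A : set 'rV[R]_n) :
  (mue n ((fun v => (v + t)%R) @^-1` A) <= mue n A)%E.
Proof.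
apply: le_ereal_inf_tmp => _ [F [mF AF] <-].
apply: ereal_inf_lbound; exists (fun k => (fun v => v + t) @^-1` F k); first split.
- by move=> k; rewrite -[X in measurable X]setTI; apply: measurable_rV_add.
- by move=> v /= /AF [k _ Fk]; exists k.
- by apply: eq_eseriesr => k _; exact: borel_lebesgue_translate.
Qed.

Lemma mu_ext_translate n (t : 'rV[R]_n) (A : set 'rV[R]_n) :
  mue n ((fun v => (v + t)%R) @^-1` A) = mue n A.
Proof.
apply/eqP; rewrite eq_le mu_ext_translate_le /=.
have := mu_ext_translate_le (- t) ((fun v => (v + t)%R) @^-1` A).
rewrite [X in mue n X](_ : _ = A)//; apply/seteqP; split => v /=; by rewrite subrK.
Qed.

Lemma measurable_leb_add n (t : 'rV[R]_n) :
  measurable_fun (setT : set (lebesgue_rV R n)) (fun v => v + t : lebesgue_rV R n).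
Proof.
move=> _ Y mY; rewrite setTI.
change (caratheodory_measurable (mue n) ((fun v : 'rV[R]_n => v + t) @^-1` Y)).
have {}mY : caratheodory_measurable (mue n) Y by exact: mY.
move=> X.
(* Every test set of the Caratheodory criterion is itself a preimage under the shift, so the
   criterion for [Y] at [X'] transfers. *)
have [X' ->] : exists X', X = (fun v : 'rV[R]_n => v + t) @^-1` X'.
  exists ((fun v : 'rV[R]_n => v + - t) @^-1` X).
  by apply/seteqP; split => v; rewrite /preimage /= addrK.
by rewrite preimage_setC -2!preimage_setI (mu_ext_translate t X')
  (mu_ext_translate t (X' `&` Y)) (mu_ext_translate t (X' `&` ~` Y)); exact: mY.
Qed.

Lemma leb_preimage_add n (t : 'rV[R]_n) (A : set (lebesgue_rV R n)) :
  leb ((fun v => (v + t)%R) @^-1` A : set (lebesgue_rV R n)) = leb A.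
Proof. exact: mu_ext_translate. Qed.

Lemma leb_translate n (t : 'rV[R]_n) (A : set 'rV[R]_n) :
  leb (translate A t : set (lebesgue_rV R n)) = leb (A : set (lebesgue_rV R n)).
Proof. exact: leb_preimage_add. Qed.

Lemma measurable_translate n (t : 'rV[R]_n) (A : set 'rV[R]_n) :
  measurable (A : set (lebesgue_rV R n)) ->
  measurable (translate A t : set (lebesgue_rV R n)).
Proof.
by move=> mA; rewrite -[X in measurable X]setTI; exact: measurable_leb_add.
Qed.

Lemma measurable_leb n (A : set 'rV[R]_n) : measurable A ->
  measurable (A : set (lebesgue_rV R n)).
Proof. exact: caratheodory_measurable_mu_ext. Qed.

Lemma measurable_leb_coord n (i : 'I_n) :
  measurable_fun (setT : set (lebesgue_rV R n)) (fun v : lebesgue_rV R n => (v : 'rV[R]_n) 0 i).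
Proof.
move=> _ Y mY; rewrite setTI; apply: measurable_leb.
by rewrite -[X in measurable X]setTI; exact: measurable_rV_coord.
Qed.

End translation.

(** * Packing bound *)

Section packing.
Context d (T : measurableType d) (R : realType).
Variable nu : {measure set T -> \bar R}.

Lemma measure_bigsetU_le (I : Type) (s : seq I) (F : I -> set T) :
  (forall i, measurable (F i)) ->
  (nu (\big[setU/set0]_(i <- s) F i) <= \sum_(i <- s) nu (F i))%E.
Proof.
move=> mF; elim: s => [|i s IHs]; first by rewrite !big_nil measure0.
rewrite !big_cons; apply: le_trans (measureU2 _ _ _) _ => //.
  exact: bigsetU_measurable.
exact: leeD.
Qed.

Lemma measure_setD_eq (A B Q : set T) : measurable A -> measurable B ->
  measurable Q -> Q `<=` A -> Q `<=` B -> nu A = nu B -> (nu A < +oo)%E ->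
  nu (A `\` Q) = nu (B `\` Q).
Proof.
move=> mA mB mQ QA QB AB Aoo.
have Boo : (nu B < +oo)%E by rewrite -AB.
rewrite (measureD mA mQ Aoo) (measureD mB mQ Boo).
by rewrite (setIidr QA) (setIidr QB); congr (_ - _)%E.
Qed.

(** From each [S (x k)] remove [V], the part outside [Q] of the [X]-indexed union; this costs at
    most [size X] times [e]. The remainders are pairwise disjoint, since overlaps lie in that union
    and miss [Q], and they all lie in the [Z]-indexed union, of mass at most [size Z] times [c]. *)
Lemma packing_bound (I : choiceType) (S : I -> set T) (Q : set T) N (x : 'I_N -> I)
    (Z X : seq I) (c e : R) :
  (forall i, measurable (S i)) -> measurable Q ->
  (forall i, nu (S i) = c%:E) ->
  all (fun i => `[< (nu (S i `\` Q) <= e%:E)%E >]) X ->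
  (forall k, S (x k) `<=` \bigcup_(i in [set` Z]) S i) ->
  (forall k l, k != l -> S (x k) `&` S (x l) `<=` \bigcup_(i in [set` X]) S i) ->
  (forall k, S (x k) `&` Q = set0) ->
  N%:R * c <= (size Z)%:R * c + N%:R * ((size X)%:R * e).
Proof.
move=> mS mQ Sc SXe SZ SX SQ.
have mU (s : seq I) : measurable (\big[setU/set0]_(i <- s) S i).
  exact: bigsetU_measurable.
pose V := \big[setU/set0]_(i <- X) (S i `\` Q).
have mV : measurable V.
  by apply: bigsetU_measurable => i _; exact: measurableD.
have VE : V = (\big[setU/set0]_(i <- X) S i) `\` Q.
  by rewrite /V -!bigcup_seq setD_bigcupl.
have Ve : (nu V <= ((size X)%:R * e)%:E)%E.
  apply: le_trans (measure_bigsetU_le _ _) _; first by move=> i; exact: measurableD.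
  elim: X SXe {SX V mV VE} => [|i s IHs] /=; first by rewrite big_nil mul0r.
  move=> /andP[/asboolP ie /IHs {}IHs].
  by rewrite big_cons -natr1 mulrDl mul1r addrC EFinD leeD.
have V_fin : nu V \is a fin_num by rewrite ge0_fin_numE// (le_lt_trans Ve) ?ltry.
pose D k := S (x k) `\` V.
have mD k : measurable (D k) by exact: measurableD.
have Dge k : ((c - (size X)%:R * e)%:E <= nu (D k))%E.
  rewrite EFinB leeBlDr// -(Sc (x k)) (measureDI nu (mS (x k)) mV) leeD2l//.
  by apply: le_trans Ve; rewrite le_measure// inE//; exact: measurableI.
have tD : trivIset setT D.
  apply/trivIsetP => k l _ _ kl; rewrite -subset0 => y [[Sk Vk] [Sl _]].
  apply: Vk; rewrite VE -bigcup_seq; split; first exact: (SX _ _ kl).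
  by move=> Qy; have : set0 y by rewrite -(SQ k).
have : (\sum_(k < N) nu (D k) <= ((size Z)%:R * c)%:E)%E.
  rewrite -measure_bigsetU_ord//.
  apply: (@le_trans _ _ (nu (\big[setU/set0]_(i <- Z) S i))).
    rewrite le_measure ?inE//; first exact: bigsetU_measurable.
    rewrite -bigcup_seq; elim/big_ind: _ => // [A B|k _]; first by rewrite subUset.
    by move=> y [+ _]; exact: SZ.
  apply: le_trans (measure_bigsetU_le _ mS) _.
  elim: Z {SZ} => [|i s IHs] /=; first by rewrite big_nil mul0r.
  by rewrite big_cons -natr1 mulrDl mul1r addrC EFinD leeD// Sc.
have : ((\sum_(k < N) (c - (size X)%:R * e))%:E <= \sum_(k < N) nu (D k))%E.
  by rewrite -sumEFin; apply: lee_sum => k _; exact: Dge.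
move=> /le_trans /[apply]; rewrite lee_fin sumr_const card_ord -[X in X <= _]mulr_natl mulrBr.
by rewrite lerBlDr addrC.
Qed.

End packing.

(** * Trigonometric polynomials *)

Lemma coord_le_norm (R : realType) n (v : 'rV[R]_n) i : `|v 0 i| <= `|v|.
Proof.
rewrite [leRHS]/Num.norm /= mx_normrE; apply/bigmax_geP; right => /=.
by exists (0, i).
Qed.

Section trig.
Context (R : realType) (d : nat).
Local Notation L := (lebesgue_rV R d).
Implicit Types (Omega Lambda : set 'rV[R]_d) (s : seq 'rV[R]_d) (c : 'rV[R]_d -> R[i]).

Lemma leb_bounded_lty (A : set 'rV[R]_d) : bounded_set A ->
  (leb (A : set L) < +oo)%E.
Proof.
move=> [M [Mr MA]].
(* Boundedness controls the norm only by numbers strictly above [M], hence a cube of half-side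
   [M + 1]. *)
pose K (i : 'I_d) : set (measurableTypeR R) := [set` `[- (M + 1), M + 1]].
have mK i : measurable (K i) by exact: measurable_itv.
apply: (@le_lt_trans _ _ (borel_lebesgue R d [set v | forall i, K i (v 0 i)])).
  have mKK : measurable [set v : 'rV[R]_d | forall i, K i (v 0 i)].
    rewrite (_ : mkset _ = \bigcap_(i in [set: 'I_d])
      (@rV_coord R d i @^-1` K i)).
      apply: fin_bigcap_measurable => // i _.
      rewrite -[X in measurable X]setTI.
      by apply: measurable_rV_coord => //; exact: mK.
    by apply/seteqP; split => v /= Av i; [move=> _; exact: Av|exact: Av].
  rewrite -[X in (_ <= X)%E](measurable_mu_extE (borel_lebesgue R d) mKK).
  change ((borel_lebesgue R d)^*%mu A <=
    (borel_lebesgue R d)^*%mu [set v : 'rV[R]_d | forall i, K i (v 0%R i)])%E.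
  apply: le_mu_ext => v Av i.
  have vM : `|v| <= M + 1 by apply: MA Av; rewrite ltrDl.
  by rewrite /K /= in_itv /= -ler_norml (le_trans _ vM)// coord_le_norm.
rewrite borel_lebesgue_prod//.
have Kfin i : lebesgue_measure (K i) \is a fin_num.
  have : lebesgue_measure ([set` `[- (M + 1), M + 1]] : set R) \is a fin_num.
    by rewrite lebesgue_measure_itv /=; case: ifP.
  done.
by rewrite -ge0_fin_numE ?prode_fin_num// prode_ge0.
Qed.

Definition trig s c : 'rV[R]_d -> R[i] := fun x => \sum_(l <- s) c l * expo l x.

Definition energy s c : 'rV[R]_d -> R := fun x => Normc.normc (trig s c x) ^+ 2.

Lemma measurable_dot (l : 'rV[R]_d) : measurable_fun (setT : set L) (dot l : L -> R).
Proof.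
apply: (@measurable_sum _ L R setT _ _ (fun i (v : L) => l 0 i * (v : 'rV[R]_d) 0 i)) => i.
exact: (@measurable_funM _ L R setT (cst (l 0 i)) _
  (@measurable_cst _ _ L _ _ _) (measurable_leb_coord i)).
Qed.

Lemma measurable_expo (l : 'rV[R]_d) :
  measurable_fun (setT : set L) (fun x : L => complex.Re (expo l x)) /\
  measurable_fun (setT : set L) (fun x : L => complex.Im (expo l x)).
Proof.
have md : measurable_fun (setT : set L) (fun x : L => 2 * pi * dot l x).
  exact: (@measurable_funM _ L R setT (cst (2 * pi)) _
    (@measurable_cst _ _ L _ _ _) (measurable_dot l)).
split.
  by apply: (measurableT_comp _ md);
    apply: continuous_measurable_fun; exact: continuous_cos.
by apply: (measurableT_comp _ md);
  apply: continuous_measurable_fun; exact: continuous_sin.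
Qed.

Lemma complexReM (x y : R[i]) : complex.Re (x * y) =
  complex.Re x * complex.Re y - complex.Im x * complex.Im y.
Proof. by case: x y => [a b] [a' b']. Qed.

Lemma complexImM (x y : R[i]) : complex.Im (x * y) =
  complex.Re x * complex.Im y + complex.Im x * complex.Re y.
Proof. by case: x y => [a b] [a' b'] /=. Qed.

Lemma complexReD (x y : R[i]) : complex.Re (x + y) = complex.Re x + complex.Re y.
Proof. by case: x y => [a b] [a' b']. Qed.

Lemma complexRe_sum (I : Type) (s : seq I) (f : I -> R[i]) :
  complex.Re (\sum_(i <- s) f i) = \sum_(i <- s) complex.Re (f i).
Proof. by apply: (big_morph _ complexReD). Qed.

Lemma complexImD (x y : R[i]) : complex.Im (x + y) = complex.Im x + complex.Im y.
Proof. by case: x y => [a b] [a' b']. Qed.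

Lemma complexIm_sum (I : Type) (s : seq I) (f : I -> R[i]) :
  complex.Im (\sum_(i <- s) f i) = \sum_(i <- s) complex.Im (f i).
Proof. by apply: (big_morph _ complexImD). Qed.

Lemma normc_sqr (x : R[i]) : Normc.normc x ^+ 2 = complex.Re (x * conjc x).
Proof.
case: x => a b; rewrite /Normc.normc sqr_sqrtr; last by rewrite addr_ge0// sqr_ge0.
by rewrite complexReM /=; ring.
Qed.

Lemma expoD (l x y : 'rV[R]_d) : expo l (x + y) = expo l x * expo l y.
Proof.
have E : dot l (x + y) = dot l x + dot l y.
  by rewrite /dot -big_split /=; apply: eq_bigr => i _; rewrite mxE mulrDr.
by rewrite /expo E mulrDr cosD sinD [X in Complex _ X]addrC.
Qed.

Lemma expo_conj (l x : 'rV[R]_d) : expo l x * conjc (expo l x) = 1.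
Proof.
rewrite /expo; set a := 2 * pi * _.
have := cos2Dsin2 a.
move=> E; apply/eqP; rewrite eq_complex /=; apply/andP.
by split; apply/eqP; [rewrite -E; ring|ring].
Qed.

(** Expanding |F|^2 into pairs of exponentials reduces its integral to the inner products that
    orthogonality controls. *)
Lemma energyE s c x : energy s c x = \sum_(l <- s) \sum_(l' <- s)
  complex.Re ((c l * conjc (c l')) * (expo l x * conjc (expo l' x))).
Proof.
rewrite /energy normc_sqr /trig rmorph_sum /= mulr_suml complexRe_sum.
apply: eq_bigr => l _; rewrite mulr_sumr complexRe_sum; apply: eq_bigr => l' _.
by rewrite rmorphM /=; congr complex.Re; ring.
Qed.

Lemma energy_ge0 s c x : 0 <= energy s c x. Proof. exact: sqr_ge0. Qed.

End trig.

(** * Energy integrals and orthogonality *)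

Section energy_integral.
Context (R : realType) (d : nat).
Local Notation L := (lebesgue_rV R d).
Implicit Types (Omega Lambda : set 'rV[R]_d) (s : seq 'rV[R]_d) (c : 'rV[R]_d -> R[i]).

Definition expo2 (l l' x : 'rV[R]_d) : R[i] := expo l x * conjc (expo l' x).

Lemma measurable_expo2 (l l' : 'rV[R]_d) :
  measurable_fun (setT : set L) (fun x : L => complex.Re (expo2 l l' x)) /\
  measurable_fun (setT : set L) (fun x : L => complex.Im (expo2 l l' x)).
Proof.
have [mc ms] := measurable_expo l; have [mc' ms'] := measurable_expo l'.
have mM := @measurable_funM _ L R setT.
split.
  rewrite (_ : (fun x : L => complex.Re (expo2 l l' x)) =
    ((fun x : L => complex.Re (expo l x)) \* (fun x : L => complex.Re (expo l' x))) \+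
    ((fun x : L => complex.Im (expo l x)) \* (fun x : L => complex.Im (expo l' x)))).
    exact: (measurable_funD (mM _ _ mc mc') (mM _ _ ms ms')).
  by apply/funext => x; rewrite /expo2 complexReM /= mulrN opprK.
rewrite (_ : (fun x : L => complex.Im (expo2 l l' x)) =
    ((fun x : L => complex.Im (expo l x)) \* (fun x : L => complex.Re (expo l' x))) \-
    ((fun x : L => complex.Re (expo l x)) \* (fun x : L => complex.Im (expo l' x)))).
  exact: (measurable_funB (mM _ _ ms mc') (mM _ _ mc ms')).
by apply/funext => x; rewrite /expo2 complexImM /= mulrN addrC.
Qed.

(** Each part is a sum of two products of sines and cosines; this crude bound gives integrability on
    sets of finite measure. *)
Lemma expo2_le (l l' x : 'rV[R]_d) :
  `|complex.Re (expo2 l l' x)| <= 2 /\ `|complex.Im (expo2 l l' x)| <= 2.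
Proof.
have cs (a b : R) : `|a| <= 1 -> `|b| <= 1 -> `|a * b| <= 1.
  by move=> a1 b1; rewrite normrM mulr_ile1.
have c1 (a : R) : `|cos a| <= 1 by rewrite ler_norml cos_geN1 cos_le1.
have s1 (a : R) : `|sin a| <= 1 by rewrite ler_norml sin_geN1 sin_le1.
split; rewrite /expo2 ?complexReM ?complexImM /= ?mulrN ?opprK; apply: le_trans (ler_normD _ _) _;
  by rewrite ?normrN (_ : 2 = 1 + 1)// lerD// cs.
Qed.

Variables (Omega : set 'rV[R]_d).
Hypothesis mO : measurable (Omega : set L).
Hypothesis Ofin : (leb (Omega : set L) < +oo)%E.

Lemma integrable_expo2 (l l' : 'rV[R]_d) :
  (@leb R d).-integrable (Omega : set L) (EFin \o (fun x : L => complex.Re (expo2 l l' x))) /\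
  (@leb R d).-integrable (Omega : set L) (EFin \o (fun x : L => complex.Im (expo2 l l' x))).
Proof.
have [mr mi] := measurable_expo2 l l'.
have B (f : L -> R) : measurable_fun setT f -> (forall x, `|f x| <= 2) ->
    (@leb R d).-integrable (Omega : set L) (EFin \o f).
  move=> mf f2; apply: (@measurable_bounded_integrable _ L R (@leb R d) f Omega mO Ofin).
    exact: measurable_funTS mf.
  exists 2; split; first exact: num_real.
  by move=> M M2 x _; exact: le_trans (f2 x) (ltW M2).
by split; apply: B => // x; have [] := expo2_le l l' x.
Qed.

Lemma integrable_expo2Z (k : R[i]) (l l' : 'rV[R]_d) :
  (@leb R d).-integrable (Omega : set L)
    (fun x : L => (complex.Re (k * expo2 l l' x))%:E).
Proof.
have [ir ii] := integrable_expo2 l l'.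
have := integrableB mO (integrableZl mO (complex.Re k) ir) (integrableZl mO (complex.Im k) ii).
by apply: eq_integrable => // x _; rewrite complexReM EFinB !EFinM.
Qed.

Lemma integral_expo2Z (k : R[i]) (l l' : 'rV[R]_d) :
  (\int[@leb R d]_(x in (Omega : set L)) (complex.Re (k * expo2 l l' x))%:E =
   (complex.Re (k * L2inner Omega (expo l) (expo l')))%:E)%E.
Proof.
have [ir ii] := integrable_expo2 l l'.
rewrite -[LHS]fineK; last by apply: integrable_fin_num => //; exact: integrable_expo2Z.
congr (_%:E).
transitivity (\int[@leb R d]_(x in (Omega : set L))
   (complex.Re k * complex.Re (expo2 l l' x) - complex.Im k * complex.Im (expo2 l l' x))).
  by apply: eq_Rintegral => x _; rewrite complexReM.
rewrite RintegralB//; first by rewrite !RintegralZl// complexReM.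
  exact: (integrableZl mO (complex.Re k) ir).
exact: (integrableZl mO (complex.Im k) ii).
Qed.

Lemma integral_energy s c :
  (\int[@leb R d]_(x in (Omega : set L)) (energy s c x)%:E =
  (\sum_(l <- s) \sum_(l' <- s)
     complex.Re (c l * conjc (c l') * L2inner Omega (expo l) (expo l')))%:E)%E.
Proof.
have I k l l' := integrable_expo2Z k l l'.
under eq_integral.
  move=> x _; rewrite energyE -sumEFin.
  under eq_bigr do rewrite -sumEFin.
  over.
rewrite integral_sum//; last first.
  by move=> l; apply: integrable_sum => // l' _; exact: I.
rewrite -sumEFin; apply: eq_bigr => l _.
rewrite integral_sum//; last by move=> l'; exact: I.
by rewrite -sumEFin; apply: eq_bigr => l' _; exact: integral_expo2Z.
Qed.

Lemma measurable_energy s c :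
  measurable_fun (setT : set L) (energy s c : L -> R).
Proof.
have -> : energy s c = (fun x : L => \sum_(l <- s) \sum_(l' <- s)
    complex.Re ((c l * conjc (c l')) * expo2 l l' x)).
  by apply/funext => x; rewrite energyE.
apply: (@measurable_sum _ L R setT _ s (fun l (x : L) => \sum_(l' <- s)
    complex.Re ((c l * conjc (c l')) * expo2 l l' x))) => l.
apply: (@measurable_sum _ L R setT _ s (fun l' (x : L) =>
    complex.Re ((c l * conjc (c l')) * expo2 l l' x))) => l'.
have [mr mi] := measurable_expo2 l l'; set k := c l * _.
have mM := @measurable_funM _ L R setT.
have -> : (fun x : L => complex.Re (k * expo2 l l' x)) =
  (cst (complex.Re k) \* (fun x : L => complex.Re (expo2 l l' x))) \-
  (cst (complex.Im k) \* (fun x : L => complex.Im (expo2 l l' x))).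
  by apply/funext => x; rewrite complexReM.
by apply: measurable_funB; apply: mM.
Qed.

Lemma energy_shift s c (t x : 'rV[R]_d) :
  energy s c (x + t) = energy s (fun l => c l * expo l t) x.
Proof.
rewrite /energy /trig; congr (Normc.normc _ ^+ 2); apply: eq_bigr => l _.
by rewrite expoD [expo l x * _]mulrC mulrA.
Qed.

(** Shifting the variable multiplies each coefficient by the unimodular number [expo l t]. By
    orthogonality only the pairs with equal frequencies contribute, and they see only |c l|^2. *)
Lemma integral_energy_translate Lambda s c (t : 'rV[R]_d) :
  orthogonal_expos Omega Lambda -> {in s, forall l, Lambda l} ->
  (\int[@leb R d]_(x in (translate Omega t : set L)) (energy s c x)%:E =
   \int[@leb R d]_(x in (Omega : set L)) (energy s c x)%:E)%E.
Proof.
move=> oO sL.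
pose c' l := c l * expo l t.
have mE : measurable_fun (Omega : set L) (energy s c' : L -> R).
  exact: measurable_funTS (measurable_energy s c').
have /measurable_EFinP mg := mE.
(* Change of variables along x -> x - t, which preserves Lebesgue measure. *)
have := ge0_integral_pushforward (measurable_leb_add (- t)) (@leb R d) mO mg.
rewrite (_ : pushforward _ _ = @leb R d); last first.
  by apply/funext => X; exact: leb_preimage_add.
move=> E; transitivity (\int[@leb R d]_(x in (Omega : set L)) (energy s c' x)%:E)%E.
  rewrite E; first by apply: eq_integral => x _; rewrite /= -energy_shift subrK.
  by move=> x _; rewrite lee_fin energy_ge0.
rewrite !integral_energy; congr (_%:E).
apply: eq_big_seq => l ls; apply: eq_big_seq => l' l's.
have [->|/eqP ll'] := eqVneq l l'; last by rewrite oO ?mulr0//; exact: sL.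
by congr (complex.Re (_ * _)); rewrite rmorphM /= mulrACA expo_conj mulr1.
Qed.

End energy_integral.

Section energy_measure.
Context (R : realType) (d : nat).
Local Notation L := (lebesgue_rV R d).
Variables (s : seq 'rV[R]_d) (c : 'rV[R]_d -> R[i]).

(** The measure |F|^2 dx, packaged as a measure so that the packing bound applies to it. *)
Definition energy_measure (E : set L) : \bar R :=
  (\int[@leb R d]_(x in E) (energy s c x)%:E)%E.

Let energy_measure0 : energy_measure set0 = 0%E.
Proof. exact: integral_set0. Qed.

Let energy_measure_ge0 E : (0 <= energy_measure E)%E.
Proof. by apply: integral_ge0 => x _; rewrite lee_fin energy_ge0. Qed.

Let energy_measure_sigma_additive : semi_sigma_additive energy_measure.
Proof.
apply: semi_sigma_additive_nng_induced => [|x]; last by rewrite lee_fin energy_ge0.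
exact/measurable_EFinP/measurable_energy.
Qed.

HB.instance Definition _ := isMeasure.Build _ _ _ energy_measure
  energy_measure0 energy_measure_ge0 energy_measure_sigma_additive.

Lemma measurable_trig :
  measurable_fun (setT : set L) (fun x : L => complex.Re (trig s c x)) /\
  measurable_fun (setT : set L) (fun x : L => complex.Im (trig s c x)).
Proof.
have mM := @measurable_funM _ L R setT.
split.
  have -> : (fun x : L => complex.Re (trig s c x)) =
      (fun x : L => \sum_(l <- s) complex.Re (c l * expo l x)).
    by apply/funext => x; rewrite /trig complexRe_sum.
  apply: (@measurable_sum _ L R setT _ s (fun l (x : L) => complex.Re (c l * expo l x))) => l.
  have [mr mi] := measurable_expo l.
  have -> : (fun x : L => complex.Re (c l * expo l x)) =
    (cst (complex.Re (c l)) \* (fun x : L => complex.Re (expo l x))) \-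
    (cst (complex.Im (c l)) \* (fun x : L => complex.Im (expo l x))).
    by apply/funext => x; rewrite complexReM.
  by apply: measurable_funB; apply: mM.
have -> : (fun x : L => complex.Im (trig s c x)) =
    (fun x : L => \sum_(l <- s) complex.Im (c l * expo l x)).
  by apply/funext => x; rewrite /trig complexIm_sum.
apply: (@measurable_sum _ L R setT _ s (fun l (x : L) => complex.Im (c l * expo l x))) => l.
have [mr mi] := measurable_expo l.
have -> : (fun x : L => complex.Im (c l * expo l x)) =
  (cst (complex.Re (c l)) \* (fun x : L => complex.Im (expo l x))) \+
  (cst (complex.Im (c l)) \* (fun x : L => complex.Re (expo l x))).
  by apply/funext => x; rewrite complexImM.
by apply: measurable_funD; apply: mM.
Qed.

End energy_measure.

(** * Concentrating the energy on a subset *)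

Section concentration.
Context (R : realType) (d : nat).
Local Notation L := (lebesgue_rV R d).

Lemma normc_sqrE (z : R[i]) : Normc.normc z ^+ 2 = complex.Re z ^+ 2 + complex.Im z ^+ 2.
Proof. by case: z => a b; rewrite /Normc.normc sqr_sqrtr// addr_ge0// sqr_ge0. Qed.

(** Take F close to the indicator of W. Off W the error is |F|^2 itself, so little energy lies
    there; on W, 1 <= 2|F|^2 + 2|1 - F|^2 bounds the energy from below. *)
Lemma concentrated_trig (Omega Lambda W : set 'rV[R]_d) (e : R) :
  measurable (Omega : set L) -> (leb (Omega : set L) < +oo)%E ->
  measurable (W : set L) -> W `<=` Omega ->
  complete_expos Omega Lambda -> 0 < e ->
  exists s c, {in s, forall l, Lambda l} /\
   (energy_measure s c (Omega `\` W) <= e%:E)%E /\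
   (leb (W : set L) <= 2%:E * energy_measure s c Omega + 2%:E * e%:E)%E.
Proof.
move=> mO Ofin mW WO compl e0.
pose f (x : 'rV[R]_d) : R[i] := Complex (\1_W x) 0.
have mW1 : measurable_fun (setT : set L) (\1_W : L -> R) by exact: measurable_indic.
have fN x : Normc.normc (f x) ^+ 2 = \1_W x.
  by rewrite normc_sqrE /f /= expr0n /= addr0 indicE; case: (_ \in _); rewrite ?expr1n ?expr0n.
have Lf : L2 Omega f.
  split.
  - exact: measurable_funTS mW1.
  - exact: measurable_cst.
  - under eq_integral do rewrite fN.
    rewrite integral_indic//; apply: le_lt_trans Ofin.
    by rewrite le_measure ?inE//; exact: measurableI.
have [s [c [sL close]]] := compl f Lf e e0.
exists s, c; split; first by move=> l /sL.
pose g (x : L) : R := Normc.normc (f x - trig s c x) ^+ 2.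
have mg : measurable_fun (setT : set L) g.
  have [mr mi] := measurable_trig s c.
  have mX := @measurable_funX _ L R setT.
  have -> : g = (fun x : L => (\1_W x - complex.Re (trig s c x)) ^+ 2) \+
     (fun x : L => (0 - complex.Im (trig s c x)) ^+ 2).
    apply/funext => x; rewrite /g normc_sqrE /f /=.
    by case: (trig s c x) => a b.
  apply: measurable_funD; apply: mX.
    exact: measurable_funB.
  exact: (@measurable_funB _ L R setT (cst 0) _ (@measurable_cst _ _ L _ _ _) mi).
have mgE (D : set L) : measurable_fun D (EFin \o g).
  by apply: measurable_funTS; exact/measurable_EFinP.
have mE (D : set L) : measurable_fun D (EFin \o (energy s c : L -> R)).
  by apply: measurable_funTS; exact/measurable_EFinP/measurable_energy.
have g0 (x : L) : (0 <= (g x)%:E)%E by rewrite lee_fin sqr_ge0.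
have close' : (\int[@leb R d]_(x in (Omega : set L)) (g x)%:E <= e%:E)%E by exact: ltW.
have mOW : measurable (Omega `\` W : set L) by exact: measurableD.
split.
  apply: le_trans close'.
  apply: (@le_trans _ _ (\int[@leb R d]_(x in (Omega `\` W : set L)) (g x)%:E)%E).
    rewrite /energy_measure le_eqVlt; apply/orP; left; apply/eqP.
    apply: eq_integral => x; rewrite inE => -[_ Wx].
    rewrite /energy /g !normc_sqrE /f indicE memNset//; congr (_%:E).
    by case: (trig s c x) => a b /=; ring.
  exact: ge0_subset_integral.
have E0 (x : L) : (0 <= (energy s c x)%:E)%E by rewrite lee_fin energy_ge0.
apply: (@le_trans _ _ (2%:E * energy_measure s c W +
    2%:E * \int[@leb R d]_(x in (W : set L)) (g x)%:E)%E); last first.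
  apply: leeD; (apply: lee_wpmul2l; first by rewrite lee_fin).
    by rewrite le_measure ?inE.
  apply: le_trans close'; apply: ge0_subset_integral => //; exact: mgE.
have g2 (x : L) : (0 <= 2%:E * (g x)%:E)%E by rewrite mule_ge0.
have E2 (x : L) : (0 <= 2%:E * (energy s c x)%:E)%E by rewrite mule_ge0.
have mg2 (D : set L) : measurable_fun D (fun x => 2%:E * (g x)%:E)%E.
  exact: measurable_funeM.
have mE2 (D : set L) : measurable_fun D (fun x => 2%:E * (energy s c x)%:E)%E.
  exact: measurable_funeM.
rewrite /energy_measure -ge0_integralZl_EFin// -[X in (_ <= _ + X)%E]ge0_integralZl_EFin//.
rewrite -ge0_integralD// -[leLHS](mul1e) -integral_cst//.
apply: ge0_le_integral; [by []|by move=> x _; rewrite /cst lee_fin|exact: measurable_cst| |].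
  exact: emeasurable_funD.
move=> x Wx; rewrite /cst -!EFinM -EFinD lee_fin /energy /g !normc_sqrE /f indicE mem_set//.
case: (trig s c x) => a b /=.
(* With F = a + ib, the excess over 1 is |2F - 1|^2. *)
have -> : 2 * (a ^+ 2 + b ^+ 2) + 2 * ((1 - a) ^+ 2 + (0 - b) ^+ 2) =
  1 + ((2 * a - 1) ^+ 2 + (2 * b) ^+ 2) by ring.
by rewrite lerDl addr_ge0// sqr_ge0.
Qed.

End concentration.

(** * Supporting hyperplanes of smooth convex bodies *)

Section expansion.
Context (R : realType) (n : nat).
Implicit Types (g : 'rV[R]_n -> R) (p q v h : 'rV[R]_n).

Lemma is_derive_line g p v (t : R) : derivable g (p + t *: v) v ->
  is_derive t 1 (fun s : R => g (p + s *: v)) ('D_v g (p + t *: v)).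
Proof.
move=> dg.
have E : (fun h : R => h^-1 *: ((fun s : R => g (p + s *: v)) (h *: 1 + t) -
    (fun s : R => g (p + s *: v)) t)) =
    (fun h : R => h^-1 *: (g (h *: v + (p + t *: v)) - g (p + t *: v))).
  apply/funext => h /=; congr (_ *: (g _ - _)).
  by rewrite scalerDl [h *: 1]mulr1 addrCA.
split; first by rewrite /derivable; have := dg; rewrite /derivable -E.
by rewrite /derive -E.
Qed.

Lemma MVT_line g p v (a : R) :
  (forall t : R, `|t| <= `|a| -> derivable g (p + t *: v) v) ->
  exists2 t, `|t| <= `|a| & g (p + a *: v) - g p = 'D_v g (p + t *: v) * a.
Proof.
move=> dg; pose f s := g (p + s *: v); pose df s := 'D_v g (p + s *: v).
have f0 : f 0 = g p by rewrite /f scale0r addr0.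
have D (t : R) : `|t| <= `|a| -> is_derive t (1 : R) f (df t).
  by move=> /dg; exact: is_derive_line.
have [a0|a0] := leP 0 a.
  have B (t : R) : t \in `[0, a] -> `|t| <= `|a|.
    by rewrite in_itv /= => /andP[t0 ta]; rewrite !ger0_norm.
  have [t tI E] : exists2 c, c \in `[0, a]%R & f a - f 0 = df c * (a - 0).
    apply: MVT_segment => // [t tI|].
      by apply: D; apply: B; apply: subset_itv_oo_cc tI.
    apply: derivable_within_continuous => t tI.
    by have [] := D _ (B _ tI).
  by exists t; [exact: B|rewrite -f0 -/(f a) E subr0].
have B (t : R) : t \in `[a, 0] -> `|t| <= `|a|.
  by rewrite in_itv /= => /andP[ta t0]; rewrite !ler0_norm ?lerN2// ltW.
have [t tI E] : exists2 c, c \in `[a, 0]%R & f 0 - f a = df c * (0 - a).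
  apply: MVT_segment => // [|t tI|]; first exact: ltW.
    by apply: D; apply: B; apply: subset_itv_oo_cc tI.
  apply: derivable_within_continuous => t tI.
  by have [] := D _ (B _ tI).
exists t; first exact: B.
by rewrite -f0 -/(f a) -opprB E sub0r mulrN opprK.
Qed.

Lemma norm_le_coord (v : 'rV[R]_n) (M : R) : 0 <= M ->
  (forall i, `|v 0 i| <= M) -> `|v| <= M.
Proof.
move=> M0 vM; rewrite [leLHS]/Num.norm /= mx_normrE.
by apply/bigmax_leP; split => // -[i j] _ /=; rewrite ord1.
Qed.

(** Continuous partial derivatives give differentiability: go from q to q + h one coordinate at a
    time and apply the mean value theorem to each move. *)
Lemma C1_expansion (U : set 'rV[R]_n) g q : open U -> U q -> smooth_on U g ->
  forall k : R, 0 < k -> exists2 r : R, 0 < r & forall h, `|h| < r ->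
    U (q + h) /\
    `|g (q + h) - g q - dot h (\row_i pderive i g q)| <= k * `|h|.
Proof.
move=> oU Uq sg k k0.
(* Each of the n moves costs at most [k'] times the norm of h; dividing by n + 1 also covers n =
   0. *)
pose k' := k / n.+1%:R.
have k'0 : 0 < k' by rewrite divr_gt0.
have nU : nbhs q U by exact: open_nbhs_nbhs.
have nd i : nbhs q [set x | `|pderive i g q - pderive i g x| < k'].
  have [+ _] := sg [:: i] q Uq.
  by move=> /cvgrPdist_lt /(_ _ k'0).
have {}nd := filter_forall (nbhs_filter q) nd.
have near_q := @filterI _ _ (nbhs_filter q) _ _ nU nd.
have [r /= r0 rP] := (nbhs_ballP _ _).1 near_q.
exists r => // h hr.
have bq x : `|x| < r -> U (q + x) /\ forall i, `|pderive i g q - pderive i g (q + x)| < k'.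
  by move=> xr; apply: rP; rewrite -ball_normE /= opprD addrA subrr sub0r normrN.
split; first by have [] := bq h hr.
(* [T j] keeps the first j coordinates of h, so it runs from 0 to h. *)
pose T j : 'rV[R]_n := \row_i (if (i < j)%N then h 0 i else 0).
have step (j : nat) : (j <= n)%N -> `|g (q + T j) - g q -
    \sum_(i < n | (i < j)%N) h 0 i * pderive i g q| <= j%:R * (k' * `|h|).
  elim: j => [_|j IHj jn].
    rewrite big_pred0 // subr0 mul0r (_ : T 0 = 0) ?addr0 ?subrr ?normr0//.
    by apply/rowP => i; rewrite !mxE.
  pose i0 := Ordinal jn; pose e : 'rV[R]_n := delta_mx 0 i0.
  have TS : T j.+1 = T j + h 0 i0 *: e.
    apply/rowP => i; rewrite !mxE eqxx /= ltnS leq_eqVlt.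
    have [->|ii0] := eqVneq i i0; first by rewrite /= eqxx ltnn add0r mulr1.
    rewrite (_ : val i == j = false) ?mulr0 ?addr0//.
    by apply: contra_neqF ii0 => /eqP ij; apply: val_inj.
  (* The norm is the sup norm, so truncating h does not increase it and the whole path stays in the
     ball. *)
  have inball (t : R) : `|t| <= `|h 0 i0| -> `|T j + t *: e| < r.
    move=> th; apply: le_lt_trans hr; apply: norm_le_coord => // i.
    rewrite !mxE eqxx /=; have [->|ii0] := eqVneq i i0.
      by rewrite ltnn add0r mulr1 (le_trans th)// coord_le_norm.
    by rewrite mulr0 addr0; case: ifP => _; rewrite ?normr0// coord_le_norm.
  have [t th E] : exists2 t, `|t| <= `|h 0 i0| &
     g (q + T j + h 0 i0 *: e) - g (q + T j) = 'D_e g (q + T j + t *: e) * h 0 i0.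
    apply: MVT_line => t th; rewrite -addrA.
    by have [Ux _] := bq _ (inball _ th); have [_ ] := sg [::] _ Ux; apply.
  rewrite TS addrA (bigD1 i0) /=; last exact: ltnSn.
  rewrite (eq_bigl (fun i : 'I_n => (i < j)%N)); last first.
    move=> i; rewrite ltnS ltn_neqAle andbC; congr (_ && _).
  have -> : g (q + T j + h 0 i0 *: e) =  g (q + T j) + 'D_e g (q + T j + t *: e) * h 0 i0.
    by rewrite -E [RHS]addrC subrK.
  rewrite -[pderive i0 g q]/('D_e g q).
  set S := \sum_(i < n | _) _; set G := g (q + T j).
  have -> : G + 'D_e g (q + T j + t *: e) * h 0 i0 - g q - (h 0 i0 * 'D_e g q + S) =
    (G - g q - S) - ('D_e g q - 'D_e g (q + T j + t *: e)) * h 0 i0 by ring.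
  have -> : j.+1%:R * (k' * `|h|) = j%:R * (k' * `|h|) + k' * `|h|.
    by rewrite -[in LHS]natr1 mulrDl mul1r.
  apply: le_trans (ler_normB _ _) _; apply: lerD; first exact/IHj/ltnW.
  rewrite normrM ler_pM ?coord_le_norm// -addrA ltW//.
  by have [_ /(_ i0)] := bq _ (inball _ th).
have := step n (leqnn n).
rewrite (_ : T n = h); last by apply/rowP => i; rewrite mxE ltn_ord.
rewrite (eq_bigl xpredT); last by move=> i; rewrite ltn_ord.
rewrite (_ : \sum_(i < n) _ = dot h (\row_i pderive i g q)); last first.
  by apply: eq_bigr => i _; rewrite mxE.
move=> /le_trans; apply; rewrite mulrA ler_wpM2r//.
rewrite /k' mulrCA; apply: ler_piMr; first exact: ltW.
by rewrite ler_pdivrMr// mul1r ler_nat.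
Qed.

End expansion.

Section dot_theory.
Context (R : realType) (n : nat).
Implicit Types (u v w : 'rV[R]_n).

Lemma dotC u v : dot u v = dot v u.
Proof. by apply: eq_bigr => i _; rewrite mulrC. Qed.

Lemma dotDl u v w : dot (u + v) w = dot u w + dot v w.
Proof. by rewrite /dot -big_split /=; apply: eq_bigr => i _; rewrite mxE mulrDl. Qed.

Lemma dotZl (k : R) u v : dot (k *: u) v = k * dot u v.
Proof. by rewrite /dot mulr_sumr; apply: eq_bigr => i _; rewrite mxE mulrA. Qed.

Lemma dotNl u v : dot (- u) v = - dot u v.
Proof. by rewrite -scaleN1r dotZl mulN1r. Qed.

Lemma dot_ge0 u : 0 <= dot u u.
Proof. by apply: sumr_ge0 => i _; exact: sqr_ge0. Qed.

Lemma dot_gt0 u : u != 0 -> 0 < dot u u.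
Proof.
move=> u0; rewrite lt_def dot_ge0 andbT; apply: contra u0.
rewrite psumr_eq0 => [/allP u0|i _]; last exact: sqr_ge0.
apply/eqP/rowP => i; have := u0 i (mem_index_enum _).
by rewrite mulf_eq0 orbb mxE => /eqP.
Qed.

Lemma dot0l u : dot 0 u = 0.
Proof. by rewrite -[X in dot X _](scale0r (0 : 'rV[R]_n)) dotZl mul0r. Qed.

Lemma dot_norm_le u v : `|dot u v| <= `|u| * \sum_i `|v 0 i|.
Proof.
rewrite mulr_sumr; apply: le_trans (ler_norm_sum _ _ _) _.
by apply: ler_sum => i _; rewrite normrM ler_wpM2r// coord_le_norm.
Qed.

Lemma dot_continuous u : continuous (fun v => dot v u).
Proof.
move=> v; apply/(@cvgrPdist_lt _ _ _ _ (nbhs_filter (v : 'rV[R]_n))) => e e0.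
pose K := \sum_i `|u 0 i| + 1.
have K0 : 0 < K by rewrite ltr_wpDl// sumr_ge0.
apply/nbhs_ballP; exists (e / K) => /=; first exact: divr_gt0.
move=> x; rewrite -ball_normE /= => vx.
rewrite -dotNl -dotDl; apply: le_lt_trans (dot_norm_le _ _) _.
move: vx; rewrite ltr_pdivlMr//; apply: le_lt_trans.
by rewrite ler_wpM2l// lerDl.
Qed.

End dot_theory.

(** * Interior and boundary points of convex sets *)

Section convexity.
Context (R : realType) (n : nat).
Implicit Types (A : set 'rV[R]_n) (x y q v w : 'rV[R]_n).

Lemma interior_ballP A x : A° x <-> exists2 r : R, 0 < r & forall h, `|h| < r -> A (x + h).
Proof.
rewrite /interior /=; split.
  move=> /nbhs_ballP[r /= r0 rA]; exists r => // h hr; apply: rA.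
  by rewrite -ball_normE /= opprD addrA subrr sub0r normrN.
move=> [r r0 rA]; apply/nbhs_ballP; exists r => // y.
rewrite -ball_normE /= => xy; rewrite -(subrK x y) addrC; apply: rA.
by rewrite distrC.
Qed.

Lemma convex_setP A : @convex_set R 'rV[R]_n A -> forall x y (t : R),
  A x -> A y -> 0 <= t <= 1 -> A (t *: x + (1 - t) *: y).
Proof.
move=> cA x y t Ax Ay t01.
case/andP: t01 => t0 t1.
by have := cA x y (Itv01 t0 t1) (mem_set Ax) (mem_set Ay); rewrite inE.
Qed.

Lemma interior_segment A x y (t : R) : @convex_set R 'rV[R]_n A ->
  A° x -> A y -> 0 < t <= 1 -> A° (t *: x + (1 - t) *: y).
Proof.
move=> cA /interior_ballP[r r0 rA] Ay /andP[t0 t1]; apply/interior_ballP.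
exists (t * r); first exact: mulr_gt0.
move=> h hr; have -> : t *: x + (1 - t) *: y + h = t *: (x + t^-1 *: h) + (1 - t) *: y.
  by rewrite scalerDr scalerA divff ?gt_eqF// scale1r addrAC.
apply: convex_setP => //; last by rewrite ltW.
by apply: rA; rewrite normrZ gtr0_norm ?invr_gt0// ltr_pdivrMl.
Qed.

(** The boundary point sits at the supremum of the parameters whose point is interior: it is a limit
    of interior points, and were it interior, slightly larger parameters would be interior too. *)
Lemma boundary_segment A x y : A° x -> ~ A° y ->
  exists2 s : R, 0 <= s <= 1 & boundary A ((1 - s) *: x + s *: y).
Proof.
move=> Ax Ay; pose f s := (1 - s) *: x + s *: y.
have fD s e : f (s + e) = f s + e *: (y - x).
  by apply/rowP => i; rewrite /f !mxE; ring.
pose S := [set s : R | 0 <= s <= 1 /\ A° (f s)].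
have S0 : S 0 by rewrite /S /= lexx ler01 /f subr0 scale1r scale0r addr0.
have ubS : ubound S 1 by move=> s [/andP[]].
have hS : has_sup S by split; [exists 0|exists 1].
pose C := `|y - x| + 1.
have C0 : 0 < C by rewrite ltr_wpDl.
have yxC : `|y - x| < C by rewrite ltrDl.
have s0 : 0 <= sup S by exact: (sup_upper_bound hS).
have s1 : sup S <= 1 by apply: ge_sup => //; exists 0.
exists (sup S); first by rewrite s0 s1.
rewrite -/(f (sup S)); split.
  move=> B /nbhs_ballP[r /= r0 rB].
  have [e Se es] := sup_adherent (divr_gt0 r0 C0) hS.
  have es' : e <= sup S by exact: (sup_upper_bound hS).
  exists (f e); split; first by case: Se => _ /interior_subset.
  have -> : f e = f (sup S) + (e - sup S) *: (y - x) by rewrite -fD addrC subrK.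
  apply: rB; rewrite -ball_normE /= opprD addrA subrr sub0r normrN normrZ distrC.
  rewrite ger0_norm ?subr_ge0//.
  have : sup S - e < r / C by rewrite ltrBlDr -ltrBlDl.
  rewrite ltr_pdivlMr//; apply: le_lt_trans.
  by rewrite ler_wpM2l ?subr_ge0// ltW.
move=> /interior_ballP[r r0 rA].
have {}s1 : sup S < 1.
  rewrite lt_neqAle s1 andbT; apply/eqP => E; apply: Ay.
  apply/interior_ballP; exists r => // h /rA.
  by rewrite /f E subrr scale0r scale1r add0r.
pose e := Num.min (1 - sup S) (r / 2 / C).
have e0 : 0 < e by rewrite lt_min subr_gt0 s1 !divr_gt0.
have e1 : e <= 1 - sup S by rewrite ge_min lexx.
have eC : e * `|y - x| <= r / 2.
  have : e <= r / 2 / C by rewrite ge_min lexx orbT.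
  by rewrite ler_pdivlMr//; apply: le_trans; apply: ler_wpM2l; exact: ltW.
suff /(sup_upper_bound hS) : S (sup S + e) by rewrite gerDl leNgt e0.
split; first by rewrite addr_ge0 ?(ltW e0)//= -lerBrDl.
apply/interior_ballP; exists (r / 2); first exact: divr_gt0.
move=> h hr; rewrite fD -addrA; apply: rA; apply: le_lt_trans (ler_normD _ _) _.
rewrite [ltRHS]splitr ler_ltD// normrZ gtr0_norm//.
Qed.

End convexity.

(** * Directions entering a body at a boundary point *)

Section tangent.
Context (R : realType) (n : nat).
Implicit Types (A : set 'rV[R]_n) (x y q v w h : 'rV[R]_n).

(** For convex A and q in A, one such t yields all smaller positive ones ([enters_le]), so these
    directions form the open cone pointing from q into the interior. *)
Definition enters A q v := exists2 t : R, 0 < t <= 1 & A° (q + t *: v).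

(** A small step from x along u stays in A and strictly increases the form. *)
Lemma interior_lt_max A q u x : u != 0 -> (forall y, A y -> dot y u <= dot q u) ->
  A° x -> dot x u < dot q u.
Proof.
move=> u0 Amax /interior_ballP[r r0 rA].
pose e := r / (`|u| + 1).
have k0 : 0 < `|u| + 1 by rewrite ltr_wpDl.
have e0 : 0 < e by rewrite divr_gt0.
have /Amax : A (x + e *: u).
  apply: rA; rewrite normrZ gtr0_norm// /e -mulrA gtr_pMr// mulrC ltr_pdivrMr//.
  by rewrite mul1r ltrDl.
by rewrite dotDl dotZl; apply: lt_le_trans; rewrite ltrDl mulr_gt0// dot_gt0.
Qed.

Lemma enters_le A q v (t t1 : R) : @convex_set R 'rV[R]_n A -> A q ->
  0 < t <= t1 -> A° (q + t1 *: v) -> A° (q + t *: v).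
Proof.
move=> cA Aq /andP[t0 tt1] A1.
have t10 : 0 < t1 by exact: lt_le_trans tt1.
have -> : q + t *: v = (t / t1) *: (q + t1 *: v) + (1 - t / t1) *: q.
  by apply/rowP => i; rewrite !mxE; field; rewrite gt_eqF.
by apply: interior_segment => //; rewrite divr_gt0//= ler_pdivrMr// mul1r.
Qed.

(* Near q the boundary is tangent to the hyperplane w^perp, so that it does not
   separate two directions lying strictly on the same side of it. *)
Lemma enters_same_side A q w v1 v2 : @convex_set R 'rV[R]_n A -> A q ->
  (forall k : R, 0 < k -> exists2 r : R, 0 < r & forall h, `|h| < r ->
     boundary A (q + h) -> `|dot h w| <= k * `|h|) ->
  0 < dot v1 w * dot v2 w -> enters A q v1 -> enters A q v2.
Proof.
move=> cA Aq flat s12 [t1 /andP[t10 t11] A1].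
(* Along the segment [u s] from v1 to v2 the form w keeps its sign and has absolute value at least
   [m], while [C] bounds the norm. *)
pose a := dot v1 w; pose b := dot v2 w; pose m := Num.min `|a| `|b|.
have m0 : 0 < m.
  rewrite lt_min !normr_gt0; apply/andP; split; apply: contraTneq s12 => E.
    by rewrite -/a E mul0r ltxx.
  by rewrite -/b E mulr0 ltxx.
pose C := `|v1| + `|v2| + 1.
have C0 : 0 < C by rewrite ltr_wpDl// addr_ge0.
pose u (s : R) := (1 - s) *: v1 + s *: v2.
have uC s : 0 <= s <= 1 -> `|u s| < C.
  move=> /andP[s0 s1]; apply: le_lt_trans (ler_normD _ _) _.
  rewrite !normrZ (ger0_norm s0) ger0_norm ?subr_ge0//.
  apply: (@le_lt_trans _ _ (`|v1| + `|v2|)); last by rewrite ltrDl.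
  by apply: lerD; rewrite ler_piMl// gerBl.
have um s : 0 <= s <= 1 -> m <= `|dot (u s) w|.
  move=> /andP[s0 s1]; rewrite /u dotDl !dotZl -/a -/b.
  have [s'0 mab] : 0 <= 1 - s /\ (m <= `|a| /\ m <= `|b|).
    by rewrite subr_ge0 s1 !ge_min !lexx orbT.
  have : 0 < a /\ 0 < b \/ a < 0 /\ b < 0.
    have [a0|a0|a0] := ltgtP a 0; [right|left|].
    - by split => //; move: s12; rewrite -/a nmulr_rgt0.
    - by split => //; move: s12; rewrite -/a pmulr_rgt0.
    - by move: s12; rewrite -/a a0 mul0r ltxx.
  case=> [[a0 b0]|[a0 b0]].
    move: mab; rewrite (gtr0_norm a0) (gtr0_norm b0) => -[ma mb].
    have -> : m = (1 - s) * m + s * m by ring.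
    apply: le_trans (ler_norm _); apply: lerD; exact: ler_wpM2l.
  move: mab; rewrite (ltr0_norm a0) (ltr0_norm b0) => -[ma mb].
  have -> : m = (1 - s) * m + s * m by ring.
  rewrite -normrN; apply: le_trans (ler_norm _); rewrite opprD -!mulrN.
  by apply: lerD; exact: ler_wpM2l.
have [r r0 rP] := flat (m / (C * 2)) (divr_gt0 m0 (mulr_gt0 C0 (ltr0n _ 2))).
pose t := Num.min t1 (r / C).
have t0 : 0 < t by rewrite lt_min t10 divr_gt0.
have tt1 : t <= t1 by rewrite ge_min lexx.
have tC : t * C <= r by rewrite -ler_pdivlMr// ge_min lexx orbT.
clear s12; clearbody t C m.
exists t; first by rewrite t0 (le_trans tt1).
apply: contrapT => nA2.
have At1 : A° (q + t *: v1) by apply: enters_le A1 => //; rewrite t0.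
(* Otherwise the segment from q + t v1 to q + t v2 meets the boundary at q + t u(s). Flatness there
   bounds the form w by t m / 2, but its absolute value is at least t m. *)
have [s s01 bs] := boundary_segment At1 nA2.
have E : (1 - s) *: (q + t *: v1) + s *: (q + t *: v2) = q + t *: u s.
  by apply/rowP => i; rewrite !mxE; ring.
rewrite E in bs.
have tun : `|t *: u s| < t * C.
  by rewrite normrZ (gtr0_norm t0) (ltr_pM2l t0) uC.
have := rP _ (lt_le_trans tun tC) bs.
apply/negP; rewrite -ltNge dotZl normrM (gtr0_norm t0).
apply: (@lt_le_trans _ _ (t * m)); last by rewrite (ler_pM2l t0) um.
apply: (@le_lt_trans _ _ (m / (C * 2) * (t * C))).
  apply: ler_wpM2l; last exact: ltW.
  exact: ltW (divr_gt0 m0 (mulr_gt0 C0 (ltr0n _ 2))).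
have -> : m / (C * 2) * (t * C) = t * m / 2 by field; rewrite gt_eqF.
have := mulr_gt0 t0 m0; lra.
Qed.

(** Here w is the gradient at q of a local defining function g. As g vanishes on the boundary, its
    linear part is there no larger than the first-order remainder. *)
Lemma smooth_boundary_flat A q : boundary A q -> smooth_hypersurface (boundary A) ->
  exists2 w, w != 0 &
  forall k : R, 0 < k -> exists2 r : R, 0 < r & forall h, `|h| < r ->
     boundary A (q + h) -> `|dot h w| <= k * `|h|.
Proof.
move=> bq /(_ q bq)[U [g [oU Uq sg gr bU]]].
exists (\row_i pderive i g q).
  have [i gi] := gr q Uq; apply: contra_neq gi => /rowP/(_ i).
  by rewrite !mxE.
move=> k k0; have [r r0 rP] := C1_expansion oU Uq sg k0.
have g0 x : boundary A x -> U x -> g x = 0.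
  by move=> bx Ux; have : (boundary A `&` U) x by []; rewrite bU => -[].
exists r => // h hr bh; have [Uh] := rP h hr.
by rewrite (g0 _ bh Uh) (g0 _ bq Uq) subrr sub0r normrN.
Qed.

(** Some direction v0 not orthogonal to the normal w enters. If v lies on its side of the hyperplane
    orthogonal to w, it enters too. Otherwise -v, tilted slightly towards v0, enters although it
    does not decrease the form u, against the maximality of q. *)
Lemma smooth_tangent A q u v : compact A -> @convex_set R 'rV[R]_n A -> A° !=set0 ->
  smooth_hypersurface (boundary A) -> A q ->
  (forall x, A x -> dot x u <= dot q u) -> dot v u < 0 -> enters A q v.
Proof.
move=> kA cA [c Ac] sA Aq Amax vu.
have u0 : u != 0.
  by apply: contraTneq vu => ->; rewrite dotC dot0l ltxx.
have bq : boundary A q.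
  split; first exact: subset_closure.
  by move=> /(interior_lt_max u0 Amax); rewrite ltxx.
have [w w0 flat] := smooth_boundary_flat bq sA.
have same v1 v2 := @enters_same_side A q w v1 v2 cA Aq flat.
have entersD v' : A° (q + v') -> enters A q v'.
  by move=> Av; exists 1; [rewrite ltr01 lexx|rewrite scale1r].
have [v0 v0w Iv0] : exists2 v0, dot v0 w != 0 & enters A q v0.
  (* Aim at an interior point c; if c - q is orthogonal to w, move c a little along w. *)
  have [cw|cw] := eqVneq (dot (c - q) w) 0; last first.
    by exists (c - q) => //; apply: entersD; rewrite addrC subrK.
  have /interior_ballP[r r0 rA] : (A°)° c by rewrite ((interior_id _).1 (open_interior A)).
  pose e := r / (`|w| + 1).
  have k0 : 0 < `|w| + 1 by rewrite ltr_wpDl.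
  have e0 : 0 < e by rewrite divr_gt0.
  exists (c - q + e *: w).
    by rewrite dotDl cw add0r dotZl mulf_neq0 ?gt_eqF// dot_gt0.
  apply: entersD; rewrite addrA [q + _]addrC subrK; apply: rA.
  rewrite normrZ gtr0_norm// /e -mulrA gtr_pMr// mulrC ltr_pdivrMr//.
  by rewrite mul1r ltrDl.
have [s0|s0] := ltP 0 (dot v0 w * dot v w); first exact: same Iv0.
exfalso.
pose S := dot v0 w; pose D := - dot v u; pose E := S * dot w u.
have D0 : 0 < D by rewrite oppr_gt0.
(* Small enough that the tilt [(t * S) *: w] changes the form u by at most [D], its value at -v. *)
pose t := D / (`|E| + 1).
have k0 : 0 < `|E| + 1 by rewrite ltr_wpDl.
have t0 : 0 < t by rewrite divr_gt0.
have [t1 /andP[t10 _]] : enters A q (- v + (t * S) *: w).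
  apply: same Iv0; rewrite dotDl dotNl dotZl mulrDr mulrN.
  rewrite ltr_wpDl ?oppr_ge0// -/S.
  have -> : S * (t * S * dot w w) = t * (S ^+ 2 * dot w w) by ring.
  by rewrite mulr_gt0// mulr_gt0 ?dot_gt0// exprn_even_gt0.
move=> /(interior_lt_max u0 Amax).
rewrite dotDl dotZl gtrDl pmulr_rlt0// dotDl dotNl dotZl -mulrA -/D -/E.
apply/negP; rewrite -leNgt.
have : t * `|E| <= D by rewrite /t mulrAC ler_pdivrMr// ler_pM2l// lerDl.
have : - (t * `|E|) <= t * E.
  by rewrite -mulrN ler_wpM2l ?(ltW t0)// lerNl -normrN ler_norm.
by lra.
Qed.

End tangent.

(** * Packing translates of a smooth symmetric body *)

Section covers.
Context (R : realType) (n : nat).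
Implicit Types (C D O K : set 'rV[R]_n) (x y : 'rV[R]_n).

Lemma lip_continuous (f : 'rV[R]_n -> 'rV[R]_n) (k : R) : 0 < k ->
  (forall x y, `|f x - f y| <= k * `|x - y|) -> continuous f.
Proof.
move=> k0 fk x; apply/(@cvgrPdist_lt _ _ _ _ (nbhs_filter (x : 'rV[R]_n))) => e e0.
apply/nbhs_ballP; exists (e / k) => /=; first exact: divr_gt0.
move=> y; rewrite -ball_normE /= ltr_pdivlMr// mulrC; exact: le_lt_trans.
Qed.

Lemma translation_continuous (t : 'rV[R]_n) : continuous (fun v : 'rV[R]_n => v + t).
Proof.
apply: (@lip_continuous _ 1) => // x y.
by rewrite mul1r opprD addrACA subrr addr0.
Qed.

Lemma rV_scale_continuous (k : R) : continuous (fun v : 'rV[R]_n => k *: v).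
Proof.
apply: (@lip_continuous _ (`|k| + 1)) => [|x y]; first by rewrite ltr_wpDl.
by rewrite -scalerBr normrZ ler_wpM2r// lerDl.
Qed.

Lemma open_translate O x : open O -> open (translate O x).
Proof.
move=> oO; by apply: open_comp => // y _; exact: translation_continuous.
Qed.

Lemma compact_translate C x : compact C -> compact (translate C x).
Proof.
move=> kC; have -> : translate C x = (fun v => v + x) @` C.
  apply/seteqP; split => [y Cy|_ [y Cy <-]]; last by rewrite /translate /= addrK.
  by exists (y - x) => //; rewrite subrK.
by apply: continuous_compact => //; apply: continuous_subspaceT; exact: translation_continuous.
Qed.

Lemma compact_scale C (k : R) : compact C -> compact [set k *: x | x in C].
Proof.
move=> kC; apply: continuous_compact => //.
exact/continuous_subspaceT/rV_scale_continuous.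
Qed.

Lemma finite_translate_cover C D O : compact C -> open O ->
  (forall y, C y -> exists2 x, D x & O (y - x)) ->
  exists2 X : seq 'rV[R]_n, {in X, forall x, D x} &
    forall y, C y -> exists2 x, x \in X & O (y - x).
Proof.
move=> kC oO CDO.
have : @cover_compact 'rV[R]_n C by rewrite -compact_cover.
move=> /(_ _ D (translate O)) [|y Cy|X XD CX].
- by move=> x _; exact: open_translate.
- by have [x Dx Oyx] := CDO y Cy; exists x.
exists (finmap.enum_fset X) => [x xX|y /CX[x xX Oyx]]; first by have := XD x xX; rewrite inE.
by exists x.
Qed.

End covers.

Lemma seq_lower_bound (R : realType) (T : eqType) (s : seq T) (P : T -> R -> Prop) :
  (forall t (e e' : R), 0 < e' <= e -> P t e -> P t e') ->
  (forall t, t \in s -> exists2 e, 0 < e & P t e) ->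
  exists2 e : R, 0 < e & forall t, t \in s -> P t e.
Proof.
move=> mono; elim: s => [|t s IHs] Ps; first by exists 1.
have [e e0 Pe] := Ps t (mem_head _ _).
have [|e' e'0 Pe'] := IHs; first by move=> t' t's; apply: Ps; rewrite inE t's orbT.
exists (Num.min e e'); first by rewrite lt_min e0.
have m0 : 0 < Num.min e e' by rewrite lt_min e0.
move=> t'; rewrite inE => /predU1P[->|/Pe' {}Pe'].
  by apply: mono Pe; rewrite m0 ge_min lexx.
by apply: mono Pe'; rewrite m0 ge_min lexx orbT.
Qed.

Lemma dot_delta (R : realType) n (a : 'I_n) (u : 'rV[R]_n) : dot (delta_mx 0 a) u = u 0 a.
Proof.
rewrite /dot (bigD1 a)//= mxE !eqxx mul1r big1 ?addr0// => i ia.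
by rewrite mxE (negbTE ia) mul0r.
Qed.

(** In the plane of two coordinates take the vectors (1, i), which are pairwise non-parallel. *)
Lemma separated_directions (R : realType) n (N : nat) : (2 <= n)%N ->
  exists u : 'I_N -> 'rV[R]_n, (forall i, u i != 0) /\
  forall i j, i != j -> exists2 v, dot v (u i) < 0 & 0 < dot v (u j).
Proof.
move=> n2; have n1 : (0 < n)%N by exact: ltnW.
pose a := Ordinal n1; pose b := Ordinal n2.
pose u (i : 'I_N) : 'rV[R]_n := delta_mx 0 a + i%:R *: delta_mx 0 b.
have ua i : u i 0 a = 1 by rewrite !mxE /= mulr0 addr0.
have ub i : u i 0 b = i%:R by rewrite !mxE /= add0r mulr1.
exists u; split=> [i|i j ij].
  by apply/eqP => /rowP/(_ a); rewrite ua mxE => /eqP; rewrite oner_eq0.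
(* The separating v is orthogonal to (1, m), which lies between (1, i) and (1, j). *)
pose m : R := (i%:R + j%:R) / 2.
have vu k (s t : R) : dot (s *: delta_mx 0 a + t *: delta_mx 0 b) (u k) = s + t * k%:R.
  by rewrite dotDl !dotZl !dot_delta ua ub mulr1.
have [ij'|ji'|/val_inj E] := ltngtP i j; last by rewrite E eqxx in ij.
- exists ((- m) *: delta_mx 0 a + 1 *: delta_mx 0 b); rewrite vu /m;
    move: ij'; rewrite -(ltr_nat R); lra.
- exists (m *: delta_mx 0 a + (-1) *: delta_mx 0 b); rewrite vu /m;
    move: ji'; rewrite -(ltr_nat R); lra.
Qed.

(** * Packing for a body symmetric about the origin *)

Section symmetric_body.
Context (R : realType) (n : nat).
Implicit Types (x y q u v : 'rV[R]_n).
Variable K : set 'rV[R]_n.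
Hypotheses (kK : compact K) (cK : @convex_set R 'rV[R]_n K) (K0 : K° !=set0).
Hypothesis symK : forall x, K x -> K (- x).
(** Smoothness enters only in this form: every direction strictly inside a supporting half-space at
    q leads into the interior. *)
Hypothesis tanK : forall q u v, K q -> (forall x, K x -> dot x u <= dot q u) ->
  dot v u < 0 -> enters K q v.

Lemma sym_interior0 : K° 0.
Proof.
have [c Kc] := K0.
have -> : 0 = 2^-1 *: c + (1 - 2^-1) *: (- c) :> 'rV[R]_n.
  by apply/rowP => i; rewrite !mxE; field.
apply: interior_segment => //; last by rewrite invr_gt0 ltr0n /= invf_le1 ?ler1n.
by apply: symK; exact: interior_subset.
Qed.

Lemma sym_scale x (t : R) : 0 <= t <= 1 -> K x -> K (t *: x).
Proof.
move=> t01 Kx; rewrite -[X in K X]addr0 -(scaler0 _ (1 - t)).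
by apply: convex_setP => //; exact: (interior_subset sym_interior0).
Qed.

Lemma sym_scale_interior x (t : R) : 0 <= t < 1 -> K x -> K° (t *: x).
Proof.
move=> /andP[t0 t1] Kx.
have -> : t *: x = (1 - t) *: 0 + (1 - (1 - t)) *: x.
  by rewrite scaler0 add0r opprB addrC subrK.
apply: interior_segment => //; first exact: sym_interior0.
by rewrite subr_gt0 t1 gerBl.
Qed.

(** The point y / 2 is the midpoint of p and y - p, both in K. If y - p has a smaller u-value than
    p, the chord enters the interior at p and its midpoint is interior; likewise for p' and u'. If
    both fail, y / 2 maximises u and u' at once, yet v enters there and increases u'. *)
Lemma meet_interior p p' u u' v y : K p -> K p' ->
  (forall x, K x -> dot x u <= dot p u) -> (forall x, K x -> dot x u' <= dot p' u') ->
  dot v u < 0 -> 0 < dot v u' -> K (y - p) -> K (y - p') -> K° (2^-1 *: y).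
Proof.
move=> Kp Kp' pmax pmax' vu vu' Kyp Kyp'.
have half q w : K q -> (forall x, K x -> dot x w <= dot q w) -> K (y - q) ->
    dot (y - q) w < dot q w -> K° (2^-1 *: y).
  move=> Kq qmax Kyq yqw.
  have [t /andP[t0 t1] Kt] : enters K q ((y - q) - q).
    by apply: tanK qmax _ => //; rewrite [X in X < 0]dotDl dotNl subr_lt0.
  (* The midpoint of q and y - q lies either between q and the interior point at parameter t, or
     between that point and y - q. *)
  have [tl|tl] := leP 2^-1 t.
    have -> : 2^-1 *: y = q + 2^-1 *: (y - q - q).
      by apply/rowP => i; rewrite !mxE; field.
    by apply: enters_le Kt => //; rewrite invr_gt0 ltr0n.
  have t'0 : 0 < 1 - t by lra.
  have -> : 2^-1 *: y = ((1 - t)^-1 / 2) *: (q + t *: (y - q - q)) +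
      (1 - (1 - t)^-1 / 2) *: (y - q).
    by apply/rowP => i; rewrite !mxE; field; rewrite gt_eqF.
  apply: interior_segment => //; apply/andP; split.
    by rewrite divr_gt0 ?invr_gt0.
  by rewrite ler_pdivrMr// mul1r -[leRHS]invrK lef_pV2 ?posrE ?invr_gt0//; lra.
have [|yu] := ltP (dot (y - p) u) (dot p u); first exact: half.
have [|yu'] := ltP (dot (y - p') u') (dot p' u'); first exact: half.
exfalso; pose q := 2^-1 *: y.
have Kq : K q.
  have -> : q = 2^-1 *: p + (1 - 2^-1) *: (y - p).
    by apply/rowP => i; rewrite !mxE; field.
  by apply: convex_setP => //; rewrite invr_ge0 ler0n /= invf_le1 ?ler1n.
have qE w z : dot q w = (dot z w + dot (y - z) w) / 2.
  by rewrite -dotDl addrC subrK /q dotZl mulrC.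
have qmax x : K x -> dot x u <= dot q u.
  move=> /pmax /le_trans; apply; rewrite (qE _ p); lra.
have [t /andP[t0 _]] := tanK Kq qmax vu.
move=> /interior_subset /pmax'; apply/negP; rewrite -ltNge dotDl dotZl.
rewrite (qE _ p'); have := mulr_gt0 t0 vu'; lra.
Qed.

Lemma open_scaled_interior (t : R) : open [set y : 'rV[R]_n | K° (t *: y)].
Proof.
apply: (@open_comp _ _ (fun y : 'rV[R]_n => t *: y) K°); last exact: open_interior.
by move=> y _; exact: rV_scale_continuous.
Qed.

(** Compactness makes [meet_interior] uniform: finitely many of the open sets [f e] cover the
    intersection, and the least such e serves all points because K is star-shaped about 0. *)
Lemma meet_shrink p p' u u' v : K p -> K p' ->
  (forall x, K x -> dot x u <= dot p u) -> (forall x, K x -> dot x u' <= dot p' u') ->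
  dot v u < 0 -> 0 < dot v u' ->
  exists2 e : R, 0 < e &
    forall y, K (y - p) -> K (y - p') -> K (((1 + e) / 2) *: y).
Proof.
move=> Kp Kp' pmax pmax' vu vu'.
have clK : closed (translate K p').
  by apply: compact_closed; [exact: norm_hausdorff|exact: compact_translate].
have kC : compact (translate K p `&` translate K p').
  by apply: compact_closedI => //; exact: compact_translate.
have : @cover_compact 'rV[R]_n (translate K p `&` translate K p').
  by rewrite -compact_cover.
pose f (e : R) := [set y : 'rV[R]_n | K° (((1 + e) / 2) *: y)].
move=> /(_ R [set e : R | 0 < e] f) [e _|y [Kyp Kyp']|X Xpos CX].
- exact: open_scaled_interior.
- have Ky : K° (2^-1 *: y) by exact: (meet_interior Kp Kp' pmax pmax' vu vu' Kyp Kyp').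
  have /interior_ballP[r r0 rK] : (K°)° (2^-1 *: y).
    by rewrite ((interior_id _).1 (open_interior K)).
  have k0 : 0 < `|y| + 1 by rewrite ltr_wpDl.
  exists (r / (`|y| + 1)); first exact: divr_gt0.
  rewrite /f /=; set e := r / _.
  have -> : ((1 + e) / 2) *: y = 2^-1 *: y + (e / 2) *: y.
    by apply/rowP => i; rewrite !mxE; field.
  apply: rK; have e0 : 0 < e by exact: divr_gt0.
  have ey : e * `|y| < r by rewrite /e mulrAC ltr_pdivrMr// ltr_pM2l// ltrDl.
  rewrite normrZ gtr0_norm ?divr_gt0//; have := mulr_ge0 (ltW e0) (normr_ge0 y); lra.
have [|t tX|e e0 eX] := @seq_lower_bound R R (finmap.enum_fset X) (fun t e => e <= t).
- by move=> t e e' /andP[_ ee']; exact: le_trans.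
- by exists t => //; have := Xpos t tX; rewrite inE.
exists e => // y Kyp Kyp'; have [t tX /interior_subset Kt] := CX y (conj Kyp Kyp').
have t0 : 0 < t by apply: lt_le_trans (eX _ tX).
have -> : ((1 + e) / 2) *: y = ((1 + e) / (1 + t)) *: (((1 + t) / 2) *: y).
  by apply/rowP => i; rewrite !mxE; field; rewrite gt_eqF// addr_gt0.
apply: sym_scale => //; have et := eX _ tX.
by rewrite divr_ge0 ?addr_ge0 ?(ltW e0) ?(ltW t0)//= ler_pdivrMr ?addr_gt0// mul1r lerD2l.
Qed.

(** The centres are [(1 + h) *: p i], with p i maximising the form u i. Translates by [Z] cover 3K,
    those by [X] cover the pairwise overlaps and contain the r-ball about 0, and r-balls centred at
    [Y] cover K. *)
Lemma sym_body_packing : (2 <= n)%N ->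
  exists (N : nat) (x : 'I_N -> 'rV[R]_n) (Z X Y : seq 'rV[R]_n) (r : R),
  [/\ (size Z < N)%N /\ 0 < r,
     forall i v, K (v - x i) -> r < `|v| /\ exists2 z, z \in Z & K (v - z),
     forall i j v, i != j -> K (v - x i) -> K (v - x j) ->
       exists2 z, z \in X & K (v - z),
     forall v, `|v| <= r -> K v /\ forall z, z \in X -> K (v - z) &
     forall v, K v -> exists2 y, y \in Y & `|v - y| <= r].
Proof.
move=> n2; have KI0 := sym_interior0.
have /interior_ballP[r0 r00 r0K] := KI0.
(* [Z] depends on K alone and is fixed first, so the number of directions can exceed its size. *)
have [|Z _ Zcov] := @finite_translate_cover R n _ setT K°
    (@compact_scale R n K 3 kK) (open_interior K).
  by move=> y _; exists y; [|rewrite subrr].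
have [u [u0 usep]] := @separated_directions R n (size Z).+1 n2.
have pex i : exists p, K p /\ forall x, K x -> dot x (u i) <= dot p (u i).
  have [||p] := @compact_EVT_max _ R (fun x : 'rV[R]_n => dot x (u i)) K _ kK.
  - by exists 0; exact: interior_subset.
  - by apply: continuous_subspaceT; exact: dot_continuous.
  - by rewrite inE => Kp pm; exists p; split => // x Kx; apply: pm; rewrite inE.
have /choice[p pP] := pex.
pose P (t : 'I_(size Z).+1 * 'I_(size Z).+1) (e : R) := t.1 != t.2 -> forall y,
    K (y - p t.1) -> K (y - p t.2) -> K (((1 + e) / 2) *: y).
have P_mono t (e e' : R) : 0 < e' <= e -> P t e -> P t e'.
  move=> /andP[e'0 e'e] Pe tt y K1 K2.
  have e0 : 0 < e by exact: lt_le_trans e'e.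
  have -> : ((1 + e') / 2) *: y = ((1 + e') / (1 + e)) *: (((1 + e) / 2) *: y).
    by apply/rowP => i; rewrite !mxE; field; rewrite gt_eqF// addr_gt0.
  apply: sym_scale; last exact: Pe.
  by rewrite divr_ge0 ?addr_ge0 ?(ltW e0) ?(ltW e'0)//= ler_pdivrMr ?addr_gt0// mul1r lerD2l.
have [e [e0 e1] eP] : exists2 e : R, 0 < e /\ e <= 1 & forall t, P t e.
  have [//|[i j] _|e e0 eP] := @seq_lower_bound R _
      (enum [set: 'I_(size Z).+1 * 'I_(size Z).+1]%SET) P.
    have [->|ij] := eqVneq i j; first by exists 1 => // /=; rewrite /P /= eqxx.
    have [v vi vj] := usep i j ij.
    have [e e0 Pe] := meet_shrink (pP i).1 (pP j).1 (pP i).2 (pP j).2 vi vj.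
    by exists e => // _; exact: Pe.
  (* Capping e by 1 gives h <= 1, which keeps K + (1 + h) p i inside 3K. *)
  exists (Num.min e 1); first by rewrite lt_min e0 ltr01 ge_min lexx orbT.
  move=> t; apply: P_mono (eP t _); last by rewrite mem_enum inE.
  by rewrite lt_min e0 ltr01 ge_min lexx.
(* Any h strictly between 0 and e makes s < 1. This s turns the factor (1 + e) / 2 of [meet_shrink]
   into overlaps inside 2sK once centres are scaled by 1 + h. *)
pose h := e / 2; pose s := (1 + h) / (1 + e).
have h0 : 0 < h by exact: divr_gt0.
have h1 : h <= 1 by rewrite /h; lra.
have he : h < e by rewrite /h; lra.
have s0 : 0 < s by rewrite divr_gt0 ?addr_gt0.
have s1 : s < 1 by rewrite ltr_pdivrMr ?addr_gt0// mul1r ltrD2l.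
have seh : 2 * s * ((1 + e) / 2) = 1 + h.
  by rewrite /s; field; rewrite gt_eqF// addr_gt0.
have [|X XD Xcov] := @finite_translate_cover R n _ [set s *: x | x in K] K°
    (@compact_scale R n K (2 * s) kK) (open_interior K).
  move=> _ [k Kk <-]; exists (s *: k); first by exists k.
  have -> : (2 * s) *: k - s *: k = s *: k by apply/rowP => i; rewrite !mxE; ring.
  by apply: sym_scale_interior => //; rewrite (ltW s0).
(* Being below (1 - s) r0 puts the r-ball in every K + z with z in sK; being below h r0 keeps it off
   the sets K + (1 + h) p i. *)
pose r := Num.min (1 - s) h * (r0 / 2).
have s'0 : 0 < 1 - s by rewrite subr_gt0.
have r_gt0 : 0 < r by rewrite mulr_gt0 ?divr_gt0// lt_min s'0.
have rs : r < (1 - s) * r0.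
  apply: (@le_lt_trans _ _ ((1 - s) * (r0 / 2))).
    by rewrite ler_wpM2r ?ge_min ?lexx// divr_ge0 // ltW.
  by rewrite ltr_pM2l// ltr_pdivrMr// ltr_pMr// ltr1n.
have rh : r < h * r0.
  apply: (@le_lt_trans _ _ (h * (r0 / 2))).
    by rewrite ler_wpM2r ?ge_min ?lexx ?orbT// divr_ge0 // ltW.
  by rewrite ltr_pM2l// ltr_pdivrMr// ltr_pMr// ltr1n.
have [|Y _ Ycov] := @finite_translate_cover R n _ setT (ball 0 r) kK (ball_open _ _).
  by move=> y _; exists y; [|rewrite subrr; exact: ballxx].
clearbody h s r.
exists (size Z).+1, (fun i => (1 + h) *: p i), Z, X, Y, r; split.
- by [].
- move=> i v Kv; have [Kp pmax] := pP i; split.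
    rewrite ltNge; apply/negP => vr.
    (* If v were in the r-ball, v / h would be interior to K, so its form would be below that of p
       i. But (1 + h) p i - v lies in K by symmetry, which forces the opposite inequality. *)
    have /(interior_lt_max (u0 i) pmax) : K° (h^-1 *: v).
      have hv : `|h^-1 *: v| < r0.
        by rewrite normrZ gtr0_norm ?invr_gt0// ltr_pdivrMl// (le_lt_trans vr).
      apply/interior_ballP; exists (r0 - `|h^-1 *: v|); first by rewrite subr_gt0.
      move=> x xr; have := r0K (h^-1 *: v + x); rewrite add0r; apply.
      by apply: le_lt_trans (ler_normD _ _) _; rewrite addrC -ltrBrDr.
    have := pmax _ (symK Kv); rewrite opprB dotDl dotNl !dotZl => A1 A2.
    have : h * (h^-1 * dot v (u i)) < h * dot (p i) (u i) by rewrite ltr_pM2l.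
    by rewrite mulrA divff ?gt_eqF// mul1r; lra.
  have [|z zZ Kz] := Zcov v; last by exists z => //; exact: (interior_subset Kz).
  (* This point of K is v / 3, a convex combination with weights 1/3 and 2/3. *)
  exists (3^-1 *: (v - (1 + h) *: p i) + (1 - 3^-1) *: (((1 + h) / 2) *: p i)).
    apply: convex_setP => //; last by rewrite invr_ge0 ler0n /= invf_le1// ler1n.
    by apply: sym_scale => //; apply/andP; split; lra.
  by apply/rowP => k; rewrite !mxE; field.
- move=> i j v ij Ki Kj; pose y := (1 + h)^-1 *: v.
  have h10 : 0 < 1 + h by exact: addr_gt0.
  have Ky k : K (v - (1 + h) *: p k) -> K (y - p k).
    move=> /(@sym_scale _ (1 + h)^-1); rewrite scalerBr scalerA mulVf ?gt_eqF// scale1r.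
    by apply; rewrite invr_ge0 (ltW h10)/= invf_le1// lerDl ltW.
  have Kk := eP (i, j) ij y (Ky _ Ki) (Ky _ Kj).
  have [|z zX Kz] := Xcov v; last by exists z => //; exact: (interior_subset Kz).
  exists (((1 + e) / 2) *: y) => //.
  by rewrite scalerA seh /y scalerA divff ?gt_eqF// scale1r.
- move=> v vr; split.
    have := r0K v; rewrite add0r; apply; apply: le_lt_trans vr _.
    by apply: lt_le_trans rs _; rewrite ler_piMl ?(ltW r00)// gerBl ltW.
  move=> z zX; have [k Kk <-] := XD z zX.
  (* A convex combination of v / (1 - s), which lies in the r0-ball, and -k. *)
  have -> : v - s *: k = (1 - s) *: ((1 - s)^-1 *: v) + (1 - (1 - s)) *: (- k).
    by apply/rowP => i; rewrite !mxE; field; rewrite gt_eqF.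
  apply: convex_setP => //; last by rewrite (ltW s'0) gerBl ltW.
    have := r0K ((1 - s)^-1 *: v); rewrite add0r; apply.
    by rewrite normrZ gtr0_norm ?invr_gt0// ltr_pdivrMl// (le_lt_trans vr).
  exact: symK.
- move=> v /Ycov[y yY]; rewrite -ball_normE /= sub0r normrN => yr.
  by exists y => //; exact: ltW.
Qed.

End symmetric_body.

(** * Product sets *)

Section symmetric_center.
Context (R : realType) (n : nat).
Implicit Types (A : set 'rV[R]_n).

Lemma translate_interior A t x : (translate A t)° x <-> A° (x - t).
Proof.
split=> /interior_ballP[r r0 rA]; apply/interior_ballP; exists r => // h /rA.
  by rewrite /translate /= addrAC.
by rewrite /translate /= addrAC.
Qed.

Lemma smooth_body_packing A : (2 <= n)%N -> convex_body A -> centrally_symmetric A ->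
  smooth_hypersurface (boundary A) ->
  exists (p : 'rV[R]_n) (N : nat) (x : 'I_N -> 'rV[R]_n) (Z X Y : seq 'rV[R]_n) (r : R),
  [/\ (size Z < N)%N /\ 0 < r,
     forall i v, A (v - x i) -> r < `|v - p| /\ exists2 z, z \in Z & A (v - z),
     forall i j v, i != j -> A (v - x i) -> A (v - x j) ->
       exists2 z, z \in X & A (v - z),
     forall v, `|v - p| <= r -> A v /\ forall z, z \in X -> A (v - z) &
     forall v, A v -> exists2 y, y \in Y & `|v - y - p| <= r].
Proof.
move=> n2 [kA cA [a Aa]] [t tA] sA.
have [p symp] : exists p, forall v, A v -> A (p + p - v).
  (* Since -A = A + t, a point v of A gives -v - t in A, so the centre is -t / 2. *)
  exists (- (2^-1 *: t)) => v Av; have : [set - x | x in A] (- v) by exists v.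
  rewrite tA => -[w Aw wt]; suff -> : - (2^-1 *: t) - (2^-1 *: t) - v = w by [].
  by rewrite -[RHS](addrK t) wt; apply/rowP => i; rewrite !mxE; field.
pose K := translate A (- p).
have KE v : K v = A (v + p) by rewrite /K /translate /= opprK.
have AK v : A v = K (v - p) by rewrite KE subrK.
have [N [x [Z [X [Y [r [ZN r_out X_cov r_in Y_cov]]]]]]] :
    exists (N : nat) (x : 'I_N -> 'rV[R]_n) (Z X Y : seq 'rV[R]_n) (r : R),
  [/\ (size Z < N)%N /\ 0 < r,
     forall i v, K (v - x i) -> r < `|v| /\ exists2 z, z \in Z & K (v - z),
     forall i j v, i != j -> K (v - x i) -> K (v - x j) ->
       exists2 z, z \in X & K (v - z),
     forall v, `|v| <= r -> K v /\ forall z, z \in X -> K (v - z) &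
     forall v, K v -> exists2 y, y \in Y & `|v - y| <= r].
  apply: sym_body_packing => //.
  - exact: compact_translate.
  - move=> v w l; rewrite !inE !KE => Kv Kw.
    have := convex_setP cA Kv Kw (t := l%:num).
    rewrite ge0 le1 => /(_ isT).
    change (A (l%:num *: (v + p) + (1 - l%:num) *: (w + p)) ->
      A (l%:num *: v + (1 - l%:num) *: w + p)).
    by congr (A _); apply/rowP => i; rewrite !mxE; ring.
  - by exists (a - p); apply/translate_interior; rewrite opprK subrK.
  - move=> v; rewrite !KE => /symp.
    by congr (A _); apply/rowP => i; rewrite !mxE; ring.
  - move=> q u v; rewrite KE => Aq qmax vu.
    have [|s s01 As] := smooth_tangent kA cA (ex_intro _ a Aa) sA Aq (u := u) (v := v) _ vu.
      move=> y Ay; have := qmax (y - p); rewrite -AK => /(_ Ay).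
      by rewrite !dotDl dotNl lerBlDr.
    exists s => //; apply/translate_interior; rewrite opprK.
    by rewrite addrAC.
exists p, N, x, Z, X, Y, r; split => //.
- move=> i v; rewrite AK addrAC => /r_out[rv [z zZ Kz]]; split=> //.
  by exists z => //; rewrite AK addrAC.
- move=> i j v ij; rewrite !AK addrAC [v - x j - p]addrAC => Ki Kj.
  by have [z zX Kz] := X_cov _ _ _ ij Ki Kj; exists z => //; rewrite AK addrAC.
- move=> v /r_in[Kv Xv]; rewrite AK; split=> // z /Xv.
  by rewrite AK addrAC.
- move=> v; rewrite AK => /Y_cov[y yY yr]; exists y => //.
  by rewrite addrAC.
Qed.

End symmetric_center.

Section box.
Context (R : realType) (n m : nat).

(** The set Q x R^m: a closed ball of the sup norm is a box Q. *)
Definition slab (p : 'rV[R]_n) (r : R) : set 'rV[R]_(n + m) :=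
  [set v | `|lsubmx v - p| <= r].

Lemma measurable_slab (p : 'rV[R]_n) (r : R) : 0 <= r ->
  measurable (slab p r : set (lebesgue_rV R (n + m))).
Proof.
move=> r0; pose c (i : 'I_n) (v : lebesgue_rV R (n + m)) : R := (v : 'rV[R]_(n + m)) 0 (lshift m i).
have -> : slab p r = \bigcap_(i in [set: 'I_n]) (c i @^-1` [set` `[p 0 i - r, p 0 i + r]]).
  apply/seteqP; split => v /=.
    move=> vr i _; have := le_trans (coord_le_norm (lsubmx v - p) i) vr.
    by rewrite !mxE ler_distl /c /= in_itv /=.
  move=> vr; apply: norm_le_coord => // i; have := vr i I.
  by rewrite /c /= in_itv /= -ler_distl !mxE.
apply: fin_bigcap_measurable => // i _; rewrite -[X in measurable X]setTI.
by apply: measurable_leb_coord => //; exact: measurable_itv.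
Qed.

End box.

(** * Contradiction from packing and concentration *)

Theorem theorem2p2 (R : realType) (n m : nat)
    (A : set 'rV[R]_n) (B : set 'rV[R]_m) :
  (2 <= n)%N -> (1 <= m)%N ->
  convex_body A -> centrally_symmetric A -> smooth_hypersurface (boundary A) ->
  bounded_set B -> measurable (B : set (lebesgue_rV R m)) ->
  ~ spectral (prod_set A B).
Proof.
move=> n2 _ bodyA symA smoothA _ _ [bO mO O_gt0 [Lambda [_ oO cO]]].
have [p [N [x [Z [X [Y [r [[ZN r0] r_out X_cov r_in Y_cov]]]]]]]] :=
  smooth_body_packing n2 bodyA symA smoothA.
set Omega := prod_set A B in bO mO O_gt0 oO cO.
have Ofin := leb_bounded_lty bO.
pose S (t : 'rV[R]_n) : set (lebesgue_rV R (n + m)) := translate Omega (row_mx t 0).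
have SE t v : S t v <-> A (lsubmx v - t) /\ B (rsubmx v).
  rewrite /S /translate /Omega /prod_set /=.
  by rewrite !linearB /= row_mxKl row_mxKr subr0.
have mS t : measurable (S t) by exact: measurable_translate.
pose W : set (lebesgue_rV R (n + m)) := Omega `&` @slab R n m p r.
have mW : measurable W by apply: measurableI => //; apply: measurable_slab; exact: ltW.
have WO : W `<=` Omega by exact: subIsetl.
have Wfin : (leb W < +oo)%E by apply: le_lt_trans Ofin; rewrite le_measure ?inE.
pose w := fine (leb W).
have wE : leb W = w%:E by rewrite fineK// ge0_fin_numE.
(* Finitely many translates of W, indexed by [Y], cover Omega; if W were null, Omega would be
   null. *)
have w0 : 0 < w.
  rewrite -lte_fin -wE lt0e measure_ge0 andbT; apply: contraTneq O_gt0 => W0.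
  rewrite -leNgt.
  apply: (@le_trans _ _ (leb (\big[setU/set0]_(y <- Y)
      (translate W (row_mx y 0) : set (lebesgue_rV R (n + m)))))).
    rewrite le_measure ?inE//.
      by apply: bigsetU_measurable => y _; exact: measurable_translate.
    rewrite -bigcup_seq => v [Av Bv]; have [y yY vy] := Y_cov _ Av; exists y => //.
    have [Avy _] := r_in _ vy.
    rewrite /translate /W /Omega /slab /prod_set /= !linearB /= row_mxKl row_mxKr subr0.
    by [].
  apply: le_trans (measure_bigsetU_le _ _ _) _.
    by move=> y; exact: measurable_translate.
  by rewrite big1// => y _; exact: etrans (leb_translate _ _) W0.
(* Chosen so that k <= N (size X) e implies 2k + 2e <= w / 2, against the lower bound w <= 2k +
   2e. *)
pose e := w / (4 * (N * size X).+1%:R).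
have e0 : 0 < e by rewrite divr_gt0// mulr_gt0.
have [s [c [sL [nuOW wle]]]] := concentrated_trig mO Ofin mW WO cO e0.
pose nu := energy_measure s c.
have nuS t : nu (S t) = nu Omega by exact: (integral_energy_translate mO Ofin c (row_mx t 0) oO sL).
pose k := fine (nu Omega).
have kE : nu Omega = k%:E.
  by rewrite fineK// /nu /energy_measure integral_energy.
have nuSk t : nu (S t) = k%:E by rewrite nuS.
have XW t : t \in X -> W `<=` S t.
  move=> tX v [[Av Bv] /r_in[_ /(_ t tX) At]]; apply/SE; by [].
have bound : N%:R * k <= (size Z)%:R * k + N%:R * ((size X)%:R * e).
  apply: (@packing_bound _ _ R nu _ S W N x Z X k e) => //.
  (* [S t] and Omega have equal energy and both contain W, so their energies outside W agree. *)
  - apply/allP => t tX; apply/asboolP.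
    have nuS_fin : (nu (S t) < +oo)%E by rewrite nuSk ltry.
    apply: le_trans nuOW; rewrite le_eqVlt; apply/orP; left; apply/eqP.
    exact: (measure_setD_eq (mS t) mO mW (XW t tX) WO (nuS t) nuS_fin).
  - move=> i v /SE[Av Bv]; have [_ [z zZ Az]] := r_out _ _ Av.
    by exists z => //; apply/SE.
  - move=> i j ij v [/SE[Ai Bv] /SE[Aj _]]; have [z zX Az] := X_cov _ _ _ ij Ai Aj.
    by exists z => //; apply/SE.
  - move=> i; rewrite -subset0 => v [/SE[Av _] [_ vr]].
    by have [] := r_out _ _ Av; rewrite ltNge vr.
have k0 : 0 <= k by rewrite fine_ge0// measure_ge0.
(* As N exceeds the size of [Z], at least one k survives the cancellation. *)
have {}bound : k <= N%:R * ((size X)%:R * e).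
  have : (size Z).+1%:R * k <= N%:R * k by rewrite ler_wpM2r// ler_nat.
  rewrite -natr1; lra.
move: wle; rewrite wE -/nu kE -!EFinM -EFinD lee_fin.
have eE : 4 * (N%:R * ((size X)%:R * e)) + 4 * e = w.
  have D : (N * size X).+1%:R = N%:R * (size X)%:R + 1 :> R by rewrite -natrM natr1.
  have D0 : (N * size X).+1%:R != 0 :> R by rewrite pnatr_eq0.
  by rewrite /e; rewrite D in D0 *; field.
by lra.
Qed.
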